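(* Let $K$ be a field and let $\Delta$ be a simplicial complex on the vertex set $[n]$ such that $R=R_\Delta$ is a normal domain. Let $P_1,\ldots,P_r$ be the minimal prime ideals of $(t)$, where $t\in R$ is the element corresponding to the empty face of $\Delta$. Then the divisor class group $\operatorname{Cl}(R)$ is generated by the classes $[P_1],\ldots,[P_r]$. Moreover, since each $R_{P_i}$ is a discrete valuation ring, one has $tR_{P_i}=P_i^{a_i}R_{P_i}$ with $a_i\in\mathbb{Z}$ for $i=1,\ldots,r$, and $\sum_{i=1}^r a_i[P_i]=0$ is the only generating relation among these generators of $\operatorname{Cl}(R)$; that is, for $b_1,\dots,b_r\in\mathbb{Z}$ one has $\sum_{i=1}^r b_i[P_i]=0$ in $\operatorname{Cl}(R)$ if and only if $(b_1,\ldots,b_r)$ is an integer multiple of $(a_1,\ldots,a_r)$.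
   Context: $[n]=\{1,\ldots,n\}$. A simplicial complex $\Delta$ on $[n]$ is a family of subsets of $[n]$ closed under taking subsets and containing all $\{i\}$, $i\in[n]$. For $F\subseteq [n]$ put $x_F=\prod_{i\in F}x_i$ (with $x_\emptyset=1$). The toric ring of $\Delta$ is the subalgebra $R_\Delta=K[x_Ft : F\in\Delta]$ of the polynomial ring $K[x_1,\ldots,x_n,t]$. *)

(* Defs.v *)
From HB Require Import structures.
From mathcomp Require Import boolp classical_sets.
From mathcomp Require Import all_boot all_order all_algebra.
From mathcomp Require Import mpoly freeg.

Set Implicit Arguments.
Unset Strict Implicit.
Unset Printing Implicit Defensive.

Import GRing.Theory.
Local Open Scope ring_scope.
Local Open Scope quotient_scope.

Notation "x %:F" := (tofrac x) : ring_scope.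

(** * Ideals and localizations of an integral domain *)

Definition normal_domain (R : idomainType) : Prop :=
  forall x : {fraction R}, integralOver (@tofrac R) x -> exists a : R, x = a%:F.

Definition prime_ideal (R : idomainType) (P : {pred R}) : Prop :=
  idealr_closed P /\ prime_idealr_closed P.

Definition principal_ideal (R : idomainType) (a : R) : {pred R} :=
  [pred x | `[< exists b : R, x = b * a >]].

Definition minimal_prime (R : idomainType) (I P : {pred R}) : Prop :=
  [/\ prime_ideal P, {subset I <= P}
    & forall Q : {pred R}, prime_ideal Q -> {subset I <= Q} ->
        {subset Q <= P} -> {subset P <= Q}].

(* The zero ideal is prime in a domain, so P has height one iff P is nonzero
   and no nonzero prime is strictly contained in P. *)
Definition height_one (R : idomainType) (P : {pred R}) : Prop :=
  [/\ prime_ideal P, exists2 x, x \in P & x != 0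
    & forall Q : {pred R}, prime_ideal Q -> (exists2 x, x \in Q & x != 0) ->
        {subset Q <= P} -> {subset P <= Q}].

Section Localization.

Variables (R : idomainType) (P : {pred R}).
Implicit Types I J : set {fraction R}.

(* The localization R_P and the extended ideal P R_P, inside Frac(R). *)
Definition loc : set {fraction R} :=
  [set x | exists a s : R, s \notin P /\ x = a%:F / s%:F]%classic.

Definition ext_ideal : set {fraction R} :=
  [set x | exists a s : R, [/\ a \in P, s \notin P & x = a%:F / s%:F]]%classic.

Definition fideal_mul I J : set {fraction R} :=
  [set x | exists (k : nat) (u v : 'I_k -> {fraction R}),
     (forall i, I (u i) /\ J (v i)) /\ x = \sum_(i < k) u i * v i]%classic.

Definition fideal_inv I : set {fraction R} :=
  [set x | forall y, I y -> loc (x * y)]%classic.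

(* The fractional ideal P^m R_P of R_P, for m an arbitrary integer. *)
Definition ext_ideal_pow (m : int) : set {fraction R} :=
  match m with
  | Posz k => iter k (fideal_mul ext_ideal) loc
  | Negz k => iter k.+1 (fideal_mul (fideal_inv ext_ideal)) loc
  end.

Definition loc_span (f : {fraction R}) : set {fraction R} :=
  [set x | exists2 y, loc y & x = f * y]%classic.

End Localization.

Definition discrete_valuation (F : fieldType) (v : F -> int) : Prop :=
  [/\ forall m : int, exists2 x : F, x != 0 & v x = m,
      forall x y : F, x != 0 -> y != 0 -> v (x * y) = v x + v y
    & forall x y : F, x != 0 -> y != 0 -> x + y != 0 ->
        Order.min (v x) (v y) <= v (x + y)].

(* V is a discrete valuation ring with field of fractions F. *)
Definition is_dvr (F : fieldType) (V : set F) : Prop :=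
  exists2 v : F -> int, discrete_valuation v
    & forall x : F, V x <-> x = 0 \/ 0 <= v x.

(** * The divisor class group *)

Record prime_divisor (R : idomainType) := PrimeDivisor {
  pd_ideal :> {pred R};
  pd_height_one : height_one pd_ideal
}.

HB.instance Definition _ (R : idomainType) := gen_eqMixin (prime_divisor R).
HB.instance Definition _ (R : idomainType) := gen_choiceMixin (prime_divisor R).

Notation weil_divisor R := {freeg (prime_divisor R) / int}.

(* D = div(f): the multiplicity of each height one prime P in D is the order
   of f at P, i.e. the exponent m with f R_P = P^m R_P. *)
Definition is_divisor_of (R : idomainType) (f : {fraction R})
    (D : weil_divisor R) : Prop :=
  forall P : prime_divisor R, loc_span P f = ext_ideal_pow P (coeff P D).

(* The subgroup generated by the divisors of nonzero fractions.  If R is a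
   noetherian normal domain these already form a subgroup; taking the span makes
   the quotient below defined for every domain. *)
Definition principal_divisor (R : idomainType) : {pred weil_divisor R} :=
  [pred D | `[< forall S : {pred weil_divisor R}, zmod_closed S ->
                  (forall (f : {fraction R}) (E : weil_divisor R),
                     f != 0 -> is_divisor_of f E -> E \in S) ->
                  D \in S >]].

Lemma principal_divisor_zmod_closed (R : idomainType) :
  zmod_closed (@principal_divisor R).
Proof.
split; first by apply/asboolP => S [].
move=> D E /asboolP hD /asboolP hE; apply/asboolP => S clS hS.
by case: (clS) => _; apply; [apply: hD | apply: hE].
Qed.

HB.instance Definition _ (R : idomainType) :=
  GRing.isZmodClosed.Build (weil_divisor R) (@principal_divisor R)
    (@principal_divisor_zmod_closed R).

Definition class_group (R : idomainType) : zmodType :=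
  Quotient.quot (@principal_divisor R).

Definition divisor_class (R : idomainType) (D : weil_divisor R) :
  class_group R := \pi_(Quotient.quot (@principal_divisor R)) D.

Definition prime_class (R : idomainType) (P : prime_divisor R) :
  class_group R := divisor_class << P >>.

(** * Toric rings of simplicial complexes *)

(* The condition on set0 only matters when n = 0. *)
Record simplicial_complex (n : nat) := SimplicialComplex {
  faces :> {set {set 'I_n}};
  faces0 : set0 \in faces;
  faces1 : forall i : 'I_n, [set i] \in faces;
  facesS : forall F G : {set 'I_n}, G \in faces -> F \subset G -> F \in faces
}.

Section ToricRing.

Variables (K : fieldType) (n : nat) (Delta : simplicial_complex n).

(* In {mpoly K[n.+1]} the variable of index i < n is x_i, the last one is t. *)
Definition toric_gen (F : {set 'I_n}) : {mpoly K[n.+1]} :=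
  (\prod_(i in F) 'X_(widen_ord (leqnSn n) i)) * 'X_ord_max.

(* Membership in the K-subalgebra generated by the x_F t with F in Delta. *)
Definition toric_pred : {pred {mpoly K[n.+1]}} :=
  [pred p | `[< forall S : {pred {mpoly K[n.+1]}}, GRing.subalg_closed S ->
                  (forall F, F \in faces Delta -> toric_gen F \in S) ->
                  p \in S >]].

Lemma toric_pred_subalg_closed : GRing.subalg_closed toric_pred.
Proof.
split.
- by apply/asboolP => S [].
- move=> a p q /asboolP hp /asboolP hq; apply/asboolP => S clS hS.
  by case: (clS) => _ + _; apply; [apply: hp | apply: hq].
- move=> p q /asboolP hp /asboolP hq; apply/asboolP => S clS hS.
  by case: (clS) => _ _; apply; [apply: hp | apply: hq].
Qed.

(* The units of {mpoly K[n.+1]} are constants, and inversion is the identity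
   elsewhere, so the subalgebra is stable under the total inverse. *)
Lemma toric_pred_divring_closed : GRing.divring_closed toric_pred.
Proof.
have [h1 hZ hM] := toric_pred_subalg_closed.
have hZ1 a p : p \in toric_pred -> a *: p \in toric_pred.
  move=> hp; have h0 : 0 \in toric_pred.
    by rewrite -(addNr (1 : {mpoly K[n.+1]})) -scaleN1r hZ.
  by rewrite -[a *: p]addr0 hZ.
split=> // p q hp hq; first by rewrite addrC -scaleN1r hZ.
apply: hM => //.
have [/unitrP [q' [qq' q'q]]|/invr_out -> //] := boolP (q \is a GRing.unit).
have /andP[/eqP q'E _] := mpoly_intro_unit q'q.
by rewrite (mulr1_eq q'q) q'E -[_%:MP]mulr1 mul_mpolyC hZ1.
Qed.

HB.instance Definition _ :=
  GRing.isDivringClosed.Build {mpoly K[n.+1]} toric_pred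
    toric_pred_divring_closed.

Record toric_ring := ToricRing {
  toric_val :> {mpoly K[n.+1]};
  toric_valP : toric_val \in toric_pred
}.

HB.instance Definition _ := [isSub for toric_val].
HB.instance Definition _ := [Choice of toric_ring by <:].
HB.instance Definition _ :=
  [SubChoice_isSubIntegralDomain of toric_ring by <:].

Lemma toric_gen_in (F : {set 'I_n}) : F \in faces Delta ->
  toric_gen F \in toric_pred.
Proof. by move=> hF; apply/asboolP => S _; apply. Qed.

(* The element t, i.e. x_F t for F the empty face. *)
Definition toric_t : toric_ring := ToricRing (toric_gen_in (faces0 Delta)).

End ToricRing.

(* Main.v *)
From HB Require Import structures.
Require Import Defs.
From mathcomp Require Import boolp classical_sets.
From mathcomp Require Import all_boot all_order all_algebra.
From mathcomp Require Import mpoly freeg.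

Set Implicit Arguments.
Unset Strict Implicit.
Unset Printing Implicit Defensive.

Import Order.TTheory GRing.Theory Num.Theory.
Local Open Scope ring_scope.

(** The argument is Nagata's: inverting the element [t] turns the toric ring
    [R] into the Laurent-type ring [K[x_1, ..., x_n][t, 1/t]], because
    [x_i = (x_i t) / t].  That ring is factorial and its units are the
    [c t^m] with [c] a nonzero constant.  Hence a height one prime [Q] that
    avoids [t] is cut out by an irreducible polynomial [p], whose divisor is
    [Q] plus a combination of the [P_i]; so the [[P_i]] generate the class
    group.  And a fraction whose divisor is supported on the [P_i] is a unit
    away from [t], that is [c t^m], with divisor [m] times that of [t]; so
    the relations are the multiples of the one given by [t].

    Two ingredients have to be supplied.

    The first is that divisors make sense: each height one prime [P] of [R]
    yields a discrete valuation ring.  [R] is Noetherian, as a quotient of a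
    polynomial ring ([hilbert_basis], [noetherian_toric]).  In a Noetherian
    normal domain, a minimal prime [P] of a nonzero element [t] is the
    annihilator of some [y] modulo [t R_P] ([associated_prime]), and
    normality forces [t / y] to generate [P R_P] ([normal_stable],
    [exists_uniformizer]); orders with respect to this generator form the
    valuation.  The same valuation shows that [P] has height one, and every
    height one prime is a minimal prime of each of its nonzero elements, so
    one construction covers all prime divisors.  Once orders are available,
    the fractional ideals [P^m R_P] are the sets of fractions of order at
    least [m] ([ext_ideal_pow_order_ge]), so that a divisor is principal if
    and only if its coefficients are the orders of one fraction
    ([principal_divisorP]).

    The second is the factoriality of [K[x_1, ..., x_n, t]]
    ([factorial_poly], [factorial_mpoly]), by induction on the number of
    variables.

    Instead of localizing [R] at [t], the polynomial ring is embedded in the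
    fraction field of [R] ([toric_embed]), compatibly with the inclusion of
    [R] in the polynomial ring ([toric_embed_val]); every polynomial falls
    into [R] after multiplication by a power of [t] ([clear_denominator]).
    Orders of polynomials then make sense at all prime divisors, and unique
    factorization takes the form of [same_orders_away]. *)

(** * Noetherian rings *)

Definition ideal (R : comNzRingType) (I : set R) : Prop :=
  I 0 /\ forall a x y : R, I x -> I y -> I (a * x + y).

(** The maximal condition on ideals gives finite generation at once, and is
    the form needed to choose a maximal annihilator. *)
Definition noetherian (R : comNzRingType) : Prop :=
  forall Fam : set (set R),
    (forall I, Fam I -> ideal I) -> (exists I, Fam I) ->
    exists2 I, Fam I & forall J, Fam J -> (I `<=` J -> J `<=` I)%classic.

Section Ideals.

Variables (R : comNzRingType) (I : set R).
Hypothesis idI : ideal I.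

Lemma ideal0 : I 0.
Proof. by case: idI. Qed.

Lemma idealMl a x : I x -> I (a * x).
Proof. by case: idI => I0 I1 Ix; rewrite -[_ * _]addr0; apply: I1. Qed.

Lemma idealD x y : I x -> I y -> I (x + y).
Proof. by case: idI => I0 I1 Ix Iy; rewrite -[x]mul1r; apply: I1. Qed.

Lemma idealB x y : I x -> I y -> I (x - y).
Proof. by move=> Ix Iy; apply: idealD => //; rewrite -mulN1r; apply: idealMl. Qed.

End Ideals.

Definition span (R : comNzRingType) (s : seq R) : set R :=
  [set x | exists c : nat -> R, x = \sum_(i < size s) c i * s`_i]%classic.

Lemma ideal_span (R : comNzRingType) (s : seq R) : ideal (span s).
Proof.
split; first by exists (fun=> 0); rewrite big1 // => i _; rewrite mul0r.
move=> a x y [c ->] [d ->]; exists (fun i => a * c i + d i).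
rewrite mulr_sumr -big_split; apply: eq_bigr => i _ /=.
by rewrite mulrDl mulrA.
Qed.

Lemma span_sub (R : comNzRingType) (s : seq R) (I : set R) :
  ideal I -> (forall x, x \in s -> I x) -> (span s `<=` I)%classic.
Proof.
move=> idI sI _ [c ->]; elim/big_rec: _ => [|i x _ Ix]; first exact: ideal0.
by apply: idealD => //; apply: idealMl => //; apply: sI; rewrite mem_nth.
Qed.

Lemma span_cons (R : comNzRingType) (x : R) (s : seq R) :
  (span s `<=` span (x :: s))%classic /\ span (x :: s) x.
Proof.
split=> [_ [c ->]|].
  exists (fun i => if i is j.+1 then c j else 0).
  by rewrite /= big_ord_recl mul0r add0r.
exists (fun i => (i == 0)%:R); rewrite /= big_ord_recl mul1r big1 ?addr0 // => i _.
by rewrite mul0r.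
Qed.

(** A maximal finitely generated ideal inside [I] absorbs every element of
    [I]. *)
Lemma noetherian_fg (R : comNzRingType) (I : set R) :
  noetherian R -> ideal I -> exists s : seq R, I = span s.
Proof.
move=> noethR idI.
pose Fam := [set J | exists2 s, (forall x, x \in s -> I x) & J = span s]%classic.
have [||_ [s sI ->] maxs] := noethR Fam.
- by move=> _ [s _ ->]; apply: ideal_span.
- by exists (span [::]), [::].
exists s; apply/seteqP; split; last exact: span_sub.
move=> x Ix; have [sub mem] := span_cons x s.
apply: (maxs (span (x :: s))) mem => //; exists (x :: s) => // y.
by rewrite inE => /orP[/eqP->|/sI].
Qed.

Lemma noetherian_surj (A B : comNzRingType) (f : {rmorphism A -> B}) :
  (forall y, exists x, f x = y) -> noetherian A -> noetherian B.
Proof.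
move=> surjf noethA Fam idFam [I0 FI0].
pose pre (I : set B) : set A := (fun x => I (f x)).
have preE I x : pre I x = I (f x) by [].
have [||_ [I FI ->] maxI] := noethA [set J | exists2 I, Fam I & J = pre I]%classic.
- move=> _ [I /idFam[I0' I1] ->]; split; first by rewrite preE rmorph0.
  by move=> a x y; rewrite !preE rmorphD rmorphM; apply: I1.
- by exists (pre I0), I0.
exists I => // J FJ sIJ y; have [x <-] := surjf y.
by rewrite -preE; apply: maxI; [exists J | move=> z; apply: sIJ].
Qed.

(** Every ideal is zero or the whole ring.  The hypothesis is on units so as to
    apply to polynomials in no variables, whose ring is a field in fact but not
    by construction. *)
Lemma noetherian_units (R : comUnitRingType) :
  (forall x : R, x != 0 -> x \is a GRing.unit) -> noetherian R.
Proof.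
move=> unitR Fam idFam [I0 FI0].
have [[I [FI [x Ix x0]]]|noI] := pselect (exists I, Fam I /\ exists2 x, I x & x != 0).
  exists I => // J _ _ y _; have idI := idFam _ FI.
  by rewrite -[y](mulrVK (unitR _ x0)); apply: idealMl.
exists I0 => // J FJ _ x Jx; have [->|x0] := eqVneq x 0.
  exact: ideal0 (idFam _ FI0).
by case: noI; exists J; split=> //; exists x.
Qed.

(** Hilbert's ideals of leading coefficients; allowing polynomials of degree
    less than [k], which contribute [0], makes them ideals. *)
Definition top_coefs (R : comNzRingType) (I : set {poly R}) (k : nat) : set R :=
  [set a | exists p, [/\ I p, (size p <= k.+1)%N & a = p`_k]]%classic.

Section HilbertBasis.

Variable R : comNzRingType.
Implicit Types I J : set {poly R}.

Lemma ideal_top_coefs I k : ideal I -> ideal (top_coefs I k).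
Proof.
move=> idI; split.
  by exists 0; rewrite size_poly0 coef0; split=> //; apply: ideal0.
move=> a _ _ [p [Ip sp ->]] [q [Iq sq ->]]; exists (a%:P * p + q).
split; last by rewrite coefD coefCM.
  by apply: idealD => //; apply: idealMl.
rewrite (leq_trans (size_polyD _ _)) // geq_max sq andbT.
by rewrite mul_polyC (leq_trans (size_scale_leq _ _)).
Qed.

Lemma top_coefs_sub I J k : (I `<=` J -> top_coefs I k `<=` top_coefs J k)%classic.
Proof. by move=> sIJ a [p [/sIJ Jp sp ap]]; exists p. Qed.

Lemma top_coefs_leq I k l : ideal I -> (k <= l)%N ->
  (top_coefs I k `<=` top_coefs I l)%classic.
Proof.
move=> idI lekl _ [p [Ip sp ->]]; exists ('X^(l - k) * p).
split; [exact: idealMl| |by rewrite mulrC coefMXn ltnNge leq_subr subKn].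
have [->|p0] := eqVneq p 0; first by rewrite mulr0 size_poly0.
by rewrite mulrC size_mulXn // -[X in (_ <= X.+1)%N](subnK lekl) -addnS leq_add2l.
Qed.

(** An element of [J] is reduced to [0] by subtracting elements of [I] of the
    same degree and leading coefficient. *)
Lemma sub_of_top_coefs I J : ideal I -> ideal J -> (I `<=` J)%classic ->
  (forall k, (top_coefs J k `<=` top_coefs I k)%classic) -> (J `<=` I)%classic.
Proof.
move=> idI idJ sIJ tcJI p; have [m] := ubnP (size p).
elim: m p => // m IHm p; rewrite ltnS => sp Jp.
have [->|p0] := eqVneq p 0; first exact: ideal0.
have sp0 : (0 < size p)%N by rewrite size_poly_gt0.
have [|q [Iq sq pq]] := tcJI (size p).-1 p`_((size p).-1).
  by exists p; split=> //; rewrite prednK.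
rewrite -(subrK q p); apply: idealD => //; apply: IHm; last first.
  by apply: idealB => //; apply: sIJ.
apply: leq_trans sp; rewrite -(prednK sp0) ltnS; apply/leq_sizeP => j.
rewrite leq_eqVlt => /orP[/eqP <-|ltj]; first by rewrite coefB pq subrr.
by rewrite coefB !nth_default ?subrr // ?(leq_trans sq) // -(prednK sp0).
Qed.

(** The ideals of leading coefficients increase with the degree and with the
    ideal, so one chooses an ideal and a degree [n] for which they are maximal,
    then enlarges the ideal to make the finitely many ideals below degree [n]
    maximal in turn. *)
Theorem hilbert_basis : noetherian R -> noetherian {poly R}.
Proof.
move=> noethR Fam idFam [I0 FI0].
(* The degree from which the leading coefficients of a well chosen ideal are
   maximal; finitely many degrees are then left. *)
have [||_ [[I n] FI ->] maxI] := noethR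
    [set L | exists2 In : set {poly R} * nat, Fam In.1 & L = top_coefs In.1 In.2]%classic.
- by move=> _ [In FIn ->]; apply: ideal_top_coefs; apply: idFam.
- by exists (top_coefs I0 0), (I0, 0%N).
have [J [FJ sIJ maxJ]] : exists J, [/\ Fam J, (I `<=` J)%classic &
    forall J' k, (k < n)%N -> Fam J' -> (J `<=` J' ->
      top_coefs J' k `<=` top_coefs J k)%classic].
  elim: (n) => [|m [J [FJ sIJ maxJ]]].
    by exists I; split=> [||J' k]; [exact: FI|exact: subset_refl|].
  have [||_ [J1 [FJ1 sJJ1 ->]] maxJ1] := noethR
      [set L | exists J', [/\ Fam J', (J `<=` J')%classic & L = top_coefs J' m]]%classic.
  - by move=> _ [J' [FJ' _ ->]]; apply: ideal_top_coefs; apply: idFam.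
  - by exists (top_coefs J m), J; split=> //; apply: subset_refl.
  exists J1; split=> [||J2 k] //; first by move=> x /sIJ /sJJ1.
  rewrite ltnS leq_eqVlt => /orP[/eqP ->|ltkm] FJ2 sJ12; last first.
    have sJJ2 : (J `<=` J2)%classic by move=> x /sJJ1 /sJ12.
    by move=> a /(maxJ _ _ ltkm FJ2 sJJ2); apply: top_coefs_sub.
  apply: maxJ1; last exact: top_coefs_sub.
  by exists J2; split=> // x /sJJ1 /sJ12.
exists J => // J' FJ' sJJ'; apply: sub_of_top_coefs => //; [exact: idFam..|] => k.
have [ltkn|lenk] := ltnP k n; first exact: maxJ.
have sII' : (I `<=` J')%classic by move=> x /sIJ /sJJ'.
move=> a J'a; apply: (top_coefs_sub sIJ); apply: (top_coefs_leq _ lenk).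
  exact: idFam FI.
apply: maxI J'a; first by exists (J', k).
move=> b Ib; apply: (top_coefs_leq _ lenk); first exact: idFam.
exact: top_coefs_sub Ib.
Qed.

End HilbertBasis.

(** * Polynomials in several variables as iterated polynomials *)

Section PolynomialIsomorphism.

Variables (n : nat) (K : fieldType).

Let mcomm (p : {mpoly K[n]}) : GRing.comm 'X_ord_max (mwiden p).
Proof. exact: mulrC. Qed.

(** The inverse of the isomorphism [muni] that isolates the last variable. *)
Definition unmuni : {poly {mpoly K[n]}} -> {mpoly K[n.+1]} :=
  horner_morph mcomm.
HB.instance Definition _ := GRing.RMorphism.on unmuni.

Lemma unmuniD p q : unmuni (p + q) = unmuni p + unmuni q.
Proof. exact: rmorphD. Qed.

Lemma unmuniM p q : unmuni (p * q) = unmuni p * unmuni q.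
Proof. exact: rmorphM. Qed.

Lemma unmuniC p : unmuni p%:P = mwiden p.
Proof. exact: horner_morphC. Qed.

Lemma unmuniX : unmuni 'X = 'X_ord_max.
Proof. exact: horner_morphX. Qed.

Lemma muni_widen (p : {mpoly K[n]}) : muni (mwiden p) = p%:P.
Proof.
elim/mpolyind: p => [|c m p _ _ IH]; first by rewrite mwiden0 muni0.
rewrite mwidenD muniD IH polyCD mwidenZ muniZ mwidenX; congr (_ + _).
rewrite muniE msuppX big_seq1 mcoeffX eqxx scale1r mnmwiden_ordmax expr0.
rewrite (_ : [multinom _ | i < n] = m); last first.
  by apply/mnmP=> i; rewrite mnmE mnmwiden_widen.
by rewrite -[_ *: 1]mul_polyC mulr1 -mul_polyC -polyCM mul_mpolyC.
Qed.

Lemma muni_X_last : muni 'X_ord_max = 'X :> {poly {mpoly K[n]}}.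
Proof.
rewrite muniE msuppX big_seq1 mcoeffX eqxx scale1r mnm1E eqxx expr1.
rewrite (_ : [multinom _ | i < n] = 0%MM) ?mpolyX0 ?scale1r //.
apply/mnmP=> i; rewrite mnmE mnm1E mnm0E.
by rewrite -val_eqE /= (gtn_eqF (ltn_ord i)).
Qed.

Lemma unmuniK : cancel unmuni (@muni n K).
Proof.
elim/poly_ind=> [|q c IH]; first by rewrite rmorph0 muni0.
by rewrite rmorphD rmorphM /= unmuniC unmuniX muniD muniM IH muni_widen muni_X_last.
Qed.

Lemma muniK : cancel (@muni n K) unmuni.
Proof.
elim/mpolyind=> [|c m p _ _ IH]; first by rewrite muni0 rmorph0.
suff mono : unmuni (muni (c *: 'X_[m])) = c *: 'X_[m].
  by rewrite muniD; apply: etrans (unmuniD _ _) (f_equal2 _ mono IH).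
rewrite muniZ -mul_polyC unmuniM unmuniC mwidenC mul_mpolyC; congr (_ *: _).
rewrite muniE msuppX big_seq1 mcoeffX eqxx scale1r -mul_polyC unmuniM rmorphXn /=.
rewrite unmuniC unmuniX mwidenX mpolyXn -mpolyXD; congr 'X_[_].
apply/mnmP=> i; rewrite mnmDE mulmnE mnm1E.
case: (unliftP ord_max i) => [j ->|->].
  rewrite (_ : fintype.lift _ j = widen_ord (leqnSn n) j); last first.
    by apply: val_inj; rewrite /= /bump leqNgt ltn_ord.
  rewrite mnmwiden_widen mnmE -val_eqE /= (gtn_eqF (ltn_ord j)).
  by rewrite mul0n addn0.
by rewrite mnmwiden_ordmax eqxx mul1n.
Qed.

End PolynomialIsomorphism.

Lemma mpoly0_unit (K : fieldType) (p : {mpoly K[0]}) :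
  p != 0 -> p \is a GRing.unit.
Proof.
move=> p0; have pE : p = (p@_0)%:MP.
  by apply/mpolyP=> m; rewrite mcoeffC; have /eqP -> : m == 0%MM
    by [apply/eqP/mnmP=> -[]]; rewrite eqxx mulr1.
have c0 : p@_0 != 0 by apply: contraNneq p0 => c0; rewrite pE c0.
by apply/unitrPr; exists (p@_0)^-1%:MP; rewrite {1}pE -mpolyCM mulfV.
Qed.

Lemma noetherian_mpoly (K : fieldType) (n : nat) : noetherian {mpoly K[n]}.
Proof.
elim: n => [|n IHn]; first exact/noetherian_units/mpoly0_unit.
have surj := @noetherian_surj {poly {mpoly K[n]}} {mpoly K[n.+1]} (@unmuni n K).
apply: surj (hilbert_basis IHn) => p; exists (muni p); exact: muniK.
Qed.
(** * Factorial domains *)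

Definition divides (R : idomainType) (a b : R) : Prop := exists c, b = c * a.

Definition prime_element (R : idomainType) (p : R) : Prop :=
  [/\ p != 0, p \isn't a GRing.unit
    & forall a b, divides p (a * b) -> divides p a \/ divides p b].

Inductive prime_product (R : idomainType) : R -> Prop :=
| PrimeProductUnit u of u \is a GRing.unit : prime_product u
| PrimeProductMul p x of prime_element p & prime_product x :
    prime_product (p * x).

(** Factors are required to be prime and not merely irreducible: existence of
    such factorizations already contains their uniqueness. *)
Definition factorial_domain (R : idomainType) : Prop :=
  forall x : R, x != 0 -> prime_product x.

Section Divisibility.

Variable R : idomainType.
Implicit Types a b c p x y : R.

Lemma divides_refl a : divides a a.
Proof. by exists 1; rewrite mul1r. Qed.

Lemma divides_mull a b c : divides a b -> divides a (c * b).
Proof. by case=> d ->; exists (c * d); rewrite mulrA. Qed.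

Lemma divides_mulr a b c : divides a b -> divides a (b * c).
Proof. by rewrite mulrC; apply: divides_mull. Qed.

Lemma divides_add a b c : divides a b -> divides a c -> divides a (b + c).
Proof. by case=> d -> [e ->]; exists (d + e); rewrite mulrDl. Qed.

Lemma divides_sub a b c : divides a b -> divides a c -> divides a (b - c).
Proof. by case=> d -> [e ->]; exists (d - e); rewrite mulrBl. Qed.

Lemma divides_trans a b c : divides a b -> divides b c -> divides a c.
Proof. by move=> ab [d ->]; apply: divides_mull. Qed.

Lemma divides_mul2l c a b : c != 0 -> divides (c * a) (c * b) -> divides a b.
Proof.
by move=> c0 [d E]; exists d; apply: (mulfI c0); rewrite E mulrCA.
Qed.

Lemma divides_unit a b : divides a b -> b \is a GRing.unit -> a \is a GRing.unit.
Proof. by case=> c ->; rewrite unitrM => /andP[]. Qed.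

Lemma prime_product_mul x y :
  prime_product x -> prime_product y -> prime_product (x * y).
Proof.
move=> ppx ppy; elim: ppx => [u uU|p z pp _ IH]; last first.
  by rewrite -mulrA; apply: PrimeProductMul.
elim: ppy => [v vU|p z pp _ IH]; last by rewrite mulrCA; apply: PrimeProductMul.
by apply: PrimeProductUnit; rewrite unitrM uU.
Qed.

Lemma prime_product_neq0 x : prime_product x -> x != 0.
Proof.
elim=> [u|p y [p0 _ _] _ y0]; last exact: mulf_neq0.
by apply: contraTneq => ->; rewrite unitr0.
Qed.

Lemma prime_product_prime p : prime_element p -> prime_product p.
Proof.
by move=> pp; rewrite -[p]mulr1; apply: PrimeProductMul => //;
   apply: PrimeProductUnit; apply: unitr1.
Qed.

End Divisibility.

Lemma prime_element_iso (A B : idomainType) (f : {rmorphism A -> B}) (g : B -> A) :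
  cancel f g -> cancel g f -> forall p, prime_element p -> prime_element (f p).
Proof.
move=> fK gK p [p0 pU pP]; have fI := can_inj fK.
have divE y : divides (f p) (f y) -> divides p y.
  by case=> c E; exists (g c); apply: fI; rewrite rmorphM gK.
split; first by rewrite -(rmorph0 f) (inj_eq fI).
  apply: contraNN pU => /unitrPr[b fpb]; apply/unitrPr; exists (g b).
  by apply: fI; rewrite rmorphM gK fpb rmorph1.
move=> a b; rewrite -[a]gK -[b]gK -rmorphM => /divE /pP[] [c ->].
  by left; exists (f c); rewrite rmorphM.
by right; exists (f c); rewrite rmorphM.
Qed.

Lemma factorial_iso (A B : idomainType) (f : {rmorphism A -> B}) (g : B -> A) :
  cancel f g -> cancel g f -> factorial_domain A -> factorial_domain B.
Proof.
move=> fK gK factA y y0.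
have : prime_product (g y).
  by apply: factA; apply: contraNneq y0 => gy0; rewrite -[y]gK gy0 rmorph0.
rewrite -{2}[y]gK; elim=> [u uU|p x pp _ IH].
  by apply: PrimeProductUnit; apply: rmorph_unit.
by rewrite rmorphM; apply: PrimeProductMul => //; apply: prime_element_iso pp.
Qed.

Section GaussLemma.

Variable R : idomainType.
Implicit Types (f g h : {poly R}) (c p : R).

Lemma divides_coef p f i : divides p%:P f -> divides p f`_i.
Proof. by case=> g ->; exists g`_i; rewrite coefMC. Qed.

Lemma divides_lead p f : divides p%:P f -> divides p (lead_coef f).
Proof. exact: divides_coef. Qed.

Lemma divides_polyC p c : divides p c -> divides p%:P c%:P.
Proof. by case=> d ->; exists d%:P; rewrite polyCM. Qed.

Lemma mulCCA p c f : p%:P * (c%:P * f) = (p * c)%:P * f.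
Proof. by rewrite polyCM mulrA. Qed.

Definition drop_lead f := f - (lead_coef f)%:P * 'X^((size f).-1).

Lemma size_drop_lead f : f != 0 -> (size (drop_lead f) < size f)%N.
Proof.
move=> f0; have sf : (0 < size f)%N by rewrite size_poly_gt0.
rewrite -(prednK sf) ltnS; apply/leq_sizeP => i.
rewrite coefB coefCM coefXn leq_eqVlt => /orP[/eqP <-|lti].
  by rewrite eqxx mulr1 subrr.
by rewrite (gtn_eqF lti) mulr0 subr0 nth_default // -(prednK sf).
Qed.

(** Gauss's lemma.  If [p] divides neither leading coefficient, it does not
    divide that of the product; a leading term that [p] divides can be dropped,
    which gives an induction on the degrees. *)
Lemma prime_polyC p : prime_element p -> prime_element p%:P.
Proof.
case=> p0 pU pP; split; first by rewrite polyC_eq0.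
  by apply: contraNN pU; rewrite poly_unitE coefC => /andP[].
move=> f g; have [m] := ubnP (size f + size g); elim: m f g => // m IHm f g.
rewrite ltnS => sm pfg.
have [->|f0] := eqVneq f 0; first by left; exists 0; rewrite mul0r.
have [->|g0] := eqVneq g 0; first by right; exists 0; rewrite mul0r.
have dropE h : h = drop_lead h + (lead_coef h)%:P * 'X^((size h).-1) by rewrite subrK.
have divT h k : divides p (lead_coef h) ->
    divides p%:P ((lead_coef h)%:P * 'X^k).
  by move=> ph; apply/divides_mulr/divides_polyC.
have := divides_lead pfg; rewrite lead_coefM => /pP[pf|pg].
- have pfg' : divides p%:P (drop_lead f * g).
    by rewrite mulrBl; apply: divides_sub => //; apply/divides_mulr/divT.
  case: (IHm _ _ _ pfg') => [|pf'|]; [|left|by right].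
    by apply: leq_trans sm; rewrite ltn_add2r size_drop_lead.
  by rewrite [f]dropE; apply: divides_add => //; apply: divT.
- have pfg' : divides p%:P (f * drop_lead g).
    by rewrite mulrBr; apply: divides_sub => //; apply/divides_mull/divT.
  case: (IHm _ _ _ pfg') => [||pg']; [|by left|right].
    by apply: leq_trans sm; rewrite ltn_add2l size_drop_lead.
  by rewrite [g]dropE; apply: divides_add => //; apply: divT.
Qed.

Lemma prime_product_polyC c : prime_product c -> prime_product c%:P.
Proof.
elim=> [u uU|p x pp _ IH].
  by apply: PrimeProductUnit; rewrite poly_unitE size_polyC coefC uU;
     have -> : u != 0 by apply: contraTneq uU => ->; rewrite unitr0.
by rewrite polyCM; apply: PrimeProductMul => //; apply: prime_polyC.
Qed.

Definition primitive f := forall p, prime_element p -> ~ divides p%:P f.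

Hypothesis factR : factorial_domain R.

(** The primes to be factored out of [f] divide its leading coefficient, so the
    induction is on a factorization of a constant [l] that all constant
    divisors of [f] divide. *)
Lemma primitive_part f : f != 0 ->
  exists c g, [/\ c != 0, primitive g & f = c%:P * g].
Proof.
move=> f0; have lf0 : lead_coef f != 0 by rewrite lead_coef_eq0.
have [l ppl divl] : exists2 x, prime_product x
    & forall c, divides c%:P f -> divides c x.
  by exists (lead_coef f); [apply: factR | move=> c; apply: divides_lead].
elim: ppl f divl {f0 lf0} => [u uU|p x pp _ IH] f divf.
  exists 1, f; rewrite oner_neq0 mul1r; split=> // p [_ pU _] /divf pu.
  by rewrite (divides_unit pu uU) in pU.
have [p0 pU pP] := pp.
have [[g fE]|npf] := pselect (divides p%:P f).
  case: (IH g) => [c [d gE]|c [h [c0 ph gE]]].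
    apply: (divides_mul2l p0); apply: divf; exists d.
    by rewrite fE gE polyCM -mulrA; congr (_ * _); rewrite mulrC.
  exists (c * p), h; rewrite mulf_neq0 // fE gE polyCM; split=> //.
  by rewrite -!mulrA; congr (_ * _); rewrite mulrC.
apply: IH => c cf; have [e E] := divf _ cf.
have : divides p (e * c) by exists x; rewrite -E mulrC.
case/pP=> [[d eE]|pc].
  by exists d; apply: (mulfI p0); rewrite E eE -mulrA mulrCA.
by case: npf; apply: divides_trans cf; apply: divides_polyC.
Qed.

Lemma primitive_const f g : primitive f -> f != 0 -> divides g f ->
  (size g <= 1)%N -> g \is a GRing.unit.
Proof.
move=> pf f0 gf /size1_polyC gE; move: gf; rewrite gE.
have [c0|c0] := eqVneq g`_0 0.
  by rewrite c0 => -[h fE]; rewrite fE mulr0 eqxx in f0.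
elim: (factR c0) => [u uU _|p x pp _ _ pxf].
  rewrite poly_unitE size_polyC coefC uU.
  by have -> : u != 0 by apply: contraTneq uU => ->; rewrite unitr0.
case: (pf _ pp); apply: divides_trans pxf.
by rewrite polyCM mulrC; apply: divides_mull; apply: divides_refl.
Qed.

Lemma primitive_cancel f c h : primitive f -> c != 0 ->
  divides f (c%:P * h) -> divides f h.
Proof.
move=> pf c0; elim: (factR c0) h => [u uU|p x pp _ IH] h [e E].
  exists (u^-1%:P * e); rewrite -mulrA -E mulrA -polyCM mulVr //.
  by rewrite mul1r.
have [p0 _ _] := pp; have [_ _ pP] := prime_polyC pp.
apply: IH; have : divides p%:P (e * f).
  by rewrite -E polyCM -mulrA mulrC; apply: divides_mull; apply: divides_refl.
case/pP=> [[d eE]|/(pf _ pp)//].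
exists d; have pP0 : p%:P != 0 by rewrite polyC_eq0.
by apply: (mulfI pP0); rewrite mulCCA E eE -mulrA mulrCA.
Qed.

(** By Gauss's lemma each prime factor of [c] can be cancelled against [g] or
    against [h]. *)
Lemma const_mul_factor f c g h : c != 0 -> c%:P * f = g * h ->
  exists a b g' h', [/\ a != 0, b != 0, g = a%:P * g', h = b%:P * h' & f = g' * h'].
Proof.
move=> c0; elim: (factR c0) g h => [u uU|p x pp _ IH] g h E.
  exists u, 1, (u^-1%:P * g), h; rewrite oner_neq0 mul1r mulrA -polyCM.
  rewrite mulrV // mul1r -mulrA -E mulrA -polyCM mulVr // mul1r.
  by split=> //; apply: contraTneq uU => ->; rewrite unitr0.
have [p0 _ _] := pp; have [pP0 _ pP] := prime_polyC pp.
have : divides p%:P (g * h).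
  by rewrite -E polyCM -mulrA mulrC; apply: divides_mull; apply: divides_refl.
case/pP=> -[d dE].
  have {}E : x%:P * f = d * h.
    by apply: (mulfI pP0); rewrite mulCCA E dE -mulrA mulrCA.
  have [a [b [g' [h' [a0 b0 gE hE fE]]]]] := IH _ _ E.
  exists (p * a), b, g', h'; split=> //; first exact: mulf_neq0.
  by rewrite dE gE polyCM mulrC mulrA.
have {}E : x%:P * f = g * d.
  by apply: (mulfI pP0); rewrite mulCCA E dE [RHS]mulrC -mulrA.
have [a [b [g' [h' [a0 b0 gE hE fE]]]]] := IH _ _ E.
exists a, (p * b), g', h'; split=> //; first exact: mulf_neq0.
by rewrite dE hE polyCM mulrC mulrA.
Qed.

(** Euclid's argument, with pseudo-division.  Let [f] divide [g * h] and let
    [d] be nonzero of least degree such that [f] divides [d * h].  Then [d]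
    divides [f] and [g] up to nonzero constants, so by irreducibility [d] is, up
    to a constant, [f], which then divides [g], or [1], and then [f] divides
    [h]. *)
Lemma prime_irreducible f : primitive f -> (1 < size f)%N ->
  (forall g h, f = g * h -> (size g <= 1)%N \/ (size h <= 1)%N) ->
  prime_element f.
Proof.
move=> pf sf irr; have f0 : f != 0 by rewrite -size_poly_gt0 ltnW.
split=> //; first by rewrite poly_unitE gtn_eqF.
move=> g h fgh; pose J d := divides f (d * h).
have Jf : J f by apply/divides_mulr/divides_refl.
have /ex_minnP[m] : exists k, `[< exists d, [/\ J d, d != 0 & size d = k] >].
  by exists (size f); apply/asboolP; exists f.
move=> /asboolP[d [Jd d0 sd]] min_m.
have lc0 k : lead_coef d ^+ k != 0 by rewrite expf_neq0 // lead_coef_eq0.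
have pseudo a : J a -> (lead_coef d ^+ scalp a d)%:P * a = a %/ d * d.
  move=> Ja; have := Pdiv.Idomain.divp_eq a d; rewrite -mul_polyC => E.
  rewrite E; have [->|r0] := eqVneq (a %% d) 0; first by rewrite addr0.
  have := ltn_modpN0 a d0; rewrite sd ltnNge min_m //.
  apply/asboolP; exists (a %% d); split=> //.
  have -> : a %% d = (lead_coef d ^+ scalp a d)%:P * a - a %/ d * d.
    by rewrite E addrC addKr.
  by rewrite /J mulrBl -!mulrA; apply: divides_sub; apply: divides_mull.
have [a [b [q' [d' [_ b0 _ dE fE]]]]] := const_mul_factor (lc0 _) (pseudo _ Jf).
case: (irr _ _ fE) => [sq'|sd'].
  have q'U : q' \is a GRing.unit.
    by apply: (primitive_const pf f0 _ sq'); exists d'; rewrite fE mulrC.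
  left; apply: (primitive_cancel pf (lc0 (scalp g d))).
  rewrite (pseudo _ fgh) dE; do 2!apply: divides_mull.
  by exists q'^-1; rewrite fE mulKr.
have d'U : d' \is a GRing.unit.
  by apply: (primitive_const pf f0 _ sd'); exists q'.
right; have : divides f (d' * h).
  by apply: (primitive_cancel pf b0); rewrite mulrA -dE.
by case=> e E; exists (d'^-1 * e); rewrite -mulrA -E mulKr.
Qed.

(** Split off the constants, then split into factors of smaller degree until
    [prime_irreducible] applies. *)
Theorem factorial_poly : factorial_domain {poly R}.
Proof.
move=> f; have [m] := ubnP (size f); elim: m f => // m IHm f; rewrite ltnS => sf f0.
have [c [g [c0 pg fE]]] := primitive_part f0.
rewrite fE; apply: prime_product_mul; first exact/prime_product_polyC/factR.
have g0 : g != 0 by apply: contraNneq f0 => g0; rewrite fE g0 mulr0.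
have sg : (size g <= m)%N by rewrite fE mul_polyC size_scale in sf.
have [sg1|sg1] := leqP (size g) 1.
  apply: PrimeProductUnit; apply: (primitive_const pg g0 _ sg1).
  exact: divides_refl.
have [[h [k [gE sh sk]]]|irr] := pselect (exists h k,
    [/\ g = h * k, (1 < size h)%N & (1 < size k)%N]); last first.
  apply/prime_product_prime/prime_irreducible => // h k gE.
  have [sh|sh] := leqP (size h) 1; first by left.
  have [sk|sk] := leqP (size k) 1; first by right.
  by case: irr; exists h, k.
have h0 : h != 0 by rewrite -size_poly_gt0 ltnW.
have k0 : k != 0 by rewrite -size_poly_gt0 ltnW.
move: sg; rewrite gE size_mul // => sg; apply: prime_product_mul; apply: IHm => //.
  by apply: leq_trans sg; rewrite -ltnS prednK ?addn_gt0 ?(ltnW sh) // -addn1 ltn_add2l.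
by apply: leq_trans sg; rewrite -ltnS prednK ?addn_gt0 ?(ltnW sh) //
   [X in (_ < X)%N]addnC -addn1 ltn_add2l.
Qed.

End GaussLemma.

Lemma factorial_mpoly (K : fieldType) (n : nat) : factorial_domain {mpoly K[n]}.
Proof.
elim: n => [|n IHn]; first by move=> p p0; apply/PrimeProductUnit/mpoly0_unit.
have iso := @factorial_iso {poly {mpoly K[n]}} {mpoly K[n.+1]} (@unmuni n K) (@muni n K).
by apply: iso (factorial_poly IHn); [exact: unmuniK | exact: muniK].
Qed.

(** * Localization at a prime ideal *)

Lemma fraction_split (R : idomainType) (x : {fraction R}) :
  exists a b : R, b != 0 /\ x = a%:F / b%:F.
Proof.
elim/quotW: x => -[[a b] /= b0]; exists a, b; split=> //.
unlock FracField.tofrac; rewrite -[_^-1]FracField.pi_inv -[RHS]FracField.pi_mul.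
congr (\pi_{fraction R}%qT _); apply: val_inj.
rewrite /= /FracField.mulf /FracField.invf.
rewrite !numden_Ratio ?(oner_eq0, mul1r, mulr1) // /Ratio.
by rewrite /insubd insubT.
Qed.

Section LocalRing.

Variables (R : idomainType) (P : {pred R}).
Hypothesis primeP : prime_ideal P.
Implicit Types (a b s u : R) (x y z : {fraction R}).

Lemma prime0 : 0 \in P.
Proof. by case: primeP => -[]. Qed.

Lemma primeMl a b : b \in P -> a * b \in P.
Proof.
by case: primeP => -[P0 _ P1] _ bP; rewrite -[_ * _]addr0; apply: P1.
Qed.

Lemma primeMr a b : a \in P -> a * b \in P.
Proof. by rewrite mulrC; apply: primeMl. Qed.

Lemma primeD a b : a \in P -> b \in P -> a + b \in P.
Proof. by case: primeP => -[_ _ P1] _ aP bP; rewrite -[a]mul1r P1. Qed.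

Lemma prime_ideal_ideal : ideal [set a | a \in P]%classic.
Proof.
split; first exact: prime0.
by move=> a x y xP yP; apply: primeD => //; apply: primeMl.
Qed.

Lemma notin_prime1 : 1 \notin P.
Proof. by case: primeP => -[]. Qed.

Lemma notin_primeM s u : s \notin P -> u \notin P -> s * u \notin P.
Proof.
case: primeP => _ pP sP uP; apply/negP => /pP.
by rewrite (negbTE sP) (negbTE uP).
Qed.

Lemma notin_prime_neq0 s : s \notin P -> s%:F != 0.
Proof. by rewrite tofrac_eq0; apply: contraNneq => ->; apply: prime0. Qed.

Lemma mem_primeX a k : a ^+ k \in P -> a \in P.
Proof.
elim: k => [|k IH]; first by rewrite expr0 (negbTE notin_prime1).
by case: primeP => _ pP; rewrite exprS => /pP/orP[].
Qed.

Lemma loc_tofrac a : loc P a%:F.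
Proof. by exists a, 1; split; [apply: notin_prime1 | rewrite tofrac1 divr1]. Qed.

Lemma loc0 : loc P 0.
Proof. by rewrite -tofrac0; apply: loc_tofrac. Qed.

Lemma loc1 : loc P 1.
Proof. by rewrite -tofrac1; apply: loc_tofrac. Qed.

Lemma locM x y : loc P x -> loc P y -> loc P (x * y).
Proof.
move=> [a [s [sP ->]]] [b [u [uP ->]]]; exists (a * b), (s * u).
by split; [apply: notin_primeM | rewrite !tofracM invfM mulrACA].
Qed.

Lemma locD x y : loc P x -> loc P y -> loc P (x + y).
Proof.
move=> [a [s [sP ->]]] [b [u [uP ->]]]; exists (a * u + b * s), (s * u).
split; first exact: notin_primeM.
by rewrite addf_div ?notin_prime_neq0 // tofracD !tofracM.
Qed.

Lemma locX x k : loc P x -> loc P (x ^+ k).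
Proof.
move=> xP; elim: k => [|k IH]; first by rewrite expr0; apply: loc1.
by rewrite exprS; apply: locM.
Qed.

Lemma loc_inv s : s \notin P -> loc P (s%:F)^-1.
Proof. by exists 1, s; rewrite tofrac1 mul1r. Qed.

Lemma ext_tofrac a : a \in P -> ext_ideal P a%:F.
Proof.
by exists a, 1; split; [|apply: notin_prime1 | rewrite tofrac1 divr1].
Qed.

Lemma ext_loc x : ext_ideal P x -> loc P x.
Proof. by move=> [a [s [_ sP ->]]]; exists a, s. Qed.

Lemma extMl x y : loc P x -> ext_ideal P y -> ext_ideal P (x * y).
Proof.
move=> [a [s [sP ->]]] [b [u [bP uP ->]]]; exists (a * b), (s * u).
split; [exact: primeMl | exact: notin_primeM |].
by rewrite !tofracM invfM mulrACA.
Qed.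

(** Membership in [P R_P] can be tested on a numerator, whatever the
    denominator outside [P]. *)
Lemma ext_clear x a s : s \notin P -> x * s%:F = a%:F -> ext_ideal P x -> a \in P.
Proof.
move=> sP E [b [u [bP uP xE]]].
have : a * u \in P.
  suff -> : a * u = b * s by apply: primeMr.
  apply/eqP; rewrite -tofrac_eq !tofracM -E xE mulrAC.
  by rewrite divfK ?notin_prime_neq0.
by case: primeP => _ pP /pP /orP[]// uP'; rewrite uP' in uP.
Qed.

Lemma ext1 : ~ ext_ideal P 1.
Proof.
move/(@ext_clear _ 1 1 notin_prime1); rewrite tofrac1 mulr1 => /(_ erefl).
by rewrite (negbTE notin_prime1).
Qed.

Lemma loc_unit x : loc P x -> ~ ext_ideal P x -> loc P x^-1.
Proof.
move=> [a [s [sP ->]]] nx; exists s, a; split; last by rewrite invf_div.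
by apply/negP => aP; apply: nx; exists a, s.
Qed.

Lemma ext_not_unit x : x != 0 -> ext_ideal P x -> ~ loc P x^-1.
Proof. by move=> x0 ex /extMl /(_ ex); rewrite mulVf //; apply: ext1. Qed.

End LocalRing.

(** ** Discrete valuation rings from minimal primes of principal ideals *)

Section Uniformizer.

Variables (R : idomainType) (P : {pred R}) (t : R).
Implicit Types (z : {fraction R}) (m : int).
Hypotheses (noethR : noetherian R) (normR : normal_domain R) (t0 : t != 0).
Hypothesis minP : minimal_prime (principal_ideal t) P.

Let primeP : prime_ideal P.
Proof. by case: minP. Qed.

Lemma minimal_prime_mem : t \in P.
Proof.
case: minP => _ tP _; apply: tP; rewrite inE.
by apply/asboolP; exists 1; rewrite mul1r.
Qed.

(** [P] is an associated prime of [t].  Among the annihilators in [R] of the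
    nonzero classes [y] of [R_P / t R_P] a maximal one is prime; it contains
    [t], and it is contained in [P] because elements outside [P] act
    invertibly; by minimality it is [P]. *)
Lemma associated_prime : exists y : R,
  ~ loc P (y%:F / t%:F) /\ forall a, a \in P -> loc P (a%:F * (y%:F / t%:F)).
Proof.
pose ann (y : R) : set R := [set a | loc P (a%:F * (y%:F / t%:F))]%classic.
have ann_id (y : R) : ideal (ann y).
  split; first by rewrite /ann /= tofrac0 mul0r; apply: loc0.
  move=> a u v au av; rewrite /ann /= tofracD tofracM mulrDl -mulrA.
  by apply: locD => //; apply: locM => //; apply: loc_tofrac.
have t1 : ~ loc P (1%:F / t%:F).
  rewrite tofrac1 mul1r; apply: ext_not_unit; rewrite ?tofrac_eq0 //.
  exact/ext_tofrac/minimal_prime_mem.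
have [||_ [y ny ->] maxy] := @noethR
    [set I | exists2 y : R, ~ loc P (y%:F / t%:F) & I = ann y]%classic.
- by move=> _ [y _ ->].
- by exists (ann 1), 1.
exists y; split=> // a aP.
pose Q : {pred R} := [pred a | `[< ann y a >]].
have QE u : (u \in Q) <-> ann y u by rewrite inE; split=> /asboolP.
suff /(_ a aP)/QE : {subset P <= Q} by [].
case: (minP) => _ _ minQ; apply: minQ.
- split; first split.
  + by apply/QE; apply: ideal0.
  + by apply/negP => /QE; rewrite /ann /= tofrac1 mul1r.
  + move=> c u v /QE uQ /QE vQ; apply/QE.
    by apply: idealD => //; apply: idealMl.
  + move=> u v /QE uvQ; apply/orP.
    have [uQ|nuQ] := pselect (ann y u); [by left; apply/QE | right].
    apply/QE; have : ann (u * y) v.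
      by rewrite /ann /= tofracM -[u%:F * _ * _]mulrA mulrA [_ * u%:F]mulrC -tofracM.
    apply: maxy.
      by exists (u * y) => //; rewrite tofracM -mulrA.
    move=> w /= yw; rewrite /ann /= tofracM -[u%:F * _ * _]mulrA mulrCA.
    by apply: locM => //; apply: loc_tofrac.
- move=> u; rewrite inE => /asboolP[b ->]; apply/QE.
  rewrite /ann /= tofracM -mulrA [t%:F * _]mulrCA mulfV ?tofrac_eq0 //.
  by rewrite mulr1 -tofracM; apply: loc_tofrac.
- move=> u /QE uy; apply/negPn/negP => uP; apply: ny.
  rewrite -[X in loc P X](mulKf (notin_prime_neq0 primeP uP)).
  by apply: locM => //; apply: loc_inv.
Qed.

(** Multiplication by [w] preserves the finitely generated ideal [P R_P].
    After clearing a common denominator [s], [w s] is an eigenvalue of a matrix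
    over [R], hence a root of its characteristic polynomial, hence in [R]. *)
Lemma normal_stable (w : {fraction R}) :
  (forall a, a \in P -> ext_ideal P (a%:F * w)) -> loc P w.
Proof.
move=> wP; have [xs PE] := noetherian_fg noethR (prime_ideal_ideal primeP).
have memP a : a \in P <-> span xs a by rewrite -PE.
have xsP x : x \in xs -> x \in P.
  move=> xxs; apply/memP; exists (fun i => (i == index x xs)%:R).
  have lti : (index x xs < size xs)%N by rewrite index_mem.
  rewrite (bigD1 (Ordinal lti)) //= eqxx mul1r nth_index // big1 ?addr0 // => i.
  by rewrite -val_eqE /= => /negbTE ->; rewrite mul0r.
have [s sP xsw] : exists2 s, s \notin P & forall x, x \in xs ->
    exists2 c, c \in P & x%:F * (w * s%:F) = c%:F.
  elim: xs xsP {PE memP} => [|x xs IH] xsP.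
    by exists 1 => //; apply: notin_prime1.
  have [|s sP xsw] := IH; first by move=> z zxs; apply: xsP; rewrite inE zxs orbT.
  have [c [u [cP uP E]]] := wP x (xsP x (mem_head _ _)).
  exists (s * u); first exact: notin_primeM.
  move=> z; rewrite inE => /orP[/eqP ->|/xsw[d dP dE]].
    exists (c * s); first exact: primeMr.
    rewrite !tofracM mulrA E [s%:F * _]mulrC mulrA divfK //.
    exact: (notin_prime_neq0 primeP).
  exists (d * u); first exact: primeMr.
  by rewrite !tofracM -dE !mulrA.
have /fin_all_exists[d dE] : forall i : 'I_(size xs), exists d : nat -> R,
    (xs`_i)%:F * (w * s%:F) = (\sum_(j < size xs) d j * xs`_j)%:F.
  move=> i; have [c /memP[d ->] E] := xsw _ (mem_nth 0 (ltn_ord i)).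
  by exists d.
pose A := \matrix_(j < size xs, i < size xs) d i j.
have : integralOver (@tofrac R) (w * s%:F).
  exists (char_poly A); first exact: char_poly_monic.
  rewrite map_char_poly -eigenvalue_root_char; apply/eigenvalueP.
  exists (\row_i (xs`_i)%:F).
    apply/rowP => i; rewrite !mxE mulrC dE rmorph_sum; apply: eq_bigr => j _.
    by rewrite !mxE rmorphM mulrC.
  have /memP[c tE] := minimal_prime_mem.
  apply: contraNneq t0 => xs0; rewrite tE big1 // => i _.
  have /rowP/(_ i) := xs0; rewrite !mxE => /eqP; rewrite tofrac_eq0 => /eqP ->.
  by rewrite mulr0.
case/normR => a /(canRL (mulfK (notin_prime_neq0 primeP sP))) ->.
by exists a, s.
Qed.

(** With [w = y / t] as in [associated_prime], [w P R_P] lies in [R_P] but, by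
    [normal_stable], not in [P R_P]; so it is [R_P] and [1 / w] generates
    [P R_P]. *)
Lemma exists_uniformizer : exists pi : {fraction R},
  [/\ pi != 0, ext_ideal P pi & forall z, ext_ideal P z -> loc P (z / pi)].
Proof.
have [y [ny yP]] := associated_prime; set w := y%:F / t%:F in ny yP.
have w0 : w != 0 by apply: contra_notN ny => /eqP ->; apply: loc0.
have [x xP nx] : exists2 x, x \in P & ~ ext_ideal P (x%:F * w).
  apply: contrapT => nx; apply: ny; apply: normal_stable => a aP.
  by apply: contrapT => na; apply: nx; exists a.
exists w^-1; rewrite invr_eq0 invrK; split=> // [|_ [a [s [aP sP ->]]]].
  have x0 : x%:F != 0.
    apply: contra_notN nx => /eqP x0; rewrite x0 mul0r -tofrac0.
    exact/ext_tofrac/prime0.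
  rewrite -[w^-1](mulfK x0) -mulrA mulrC -mulrA -invfM mulrC.
  by apply: (extMl primeP); [apply: loc_unit (yP _ xP) nx | apply: ext_tofrac].
by rewrite mulrAC; apply: locM; [|apply: yP|apply: loc_inv].
Qed.

Variable pi : {fraction R}.
Hypotheses (pi0 : pi != 0) (piP : ext_ideal P pi).
Hypothesis pi_div : forall z, ext_ideal P z -> loc P (z / pi).

(** If [z / pi^k] stayed in [R_P], the ideals of multiples of [z / pi^k] would
    increase with [k], and as soon as two consecutive ones agree [pi] is a
    unit. *)
Lemma uniformizer_bound z : z != 0 -> exists k, ~ loc P (z / pi ^+ k).
Proof.
move=> z0; apply: contrapT => nk.
have zk k : loc P (z / pi ^+ k) by apply: contrapT => ?; apply: nk; exists k.
have zkS k : z / pi ^+ k.+1 = z / pi ^+ k / pi by rewrite exprSr invfM mulrA.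
have zk0 k : z / pi ^+ k != 0 by apply/mulf_neq0/invr_neq0/expf_neq0.
pose J k : set R := [set r | loc P (r%:F / (z / pi ^+ k))]%classic.
have [||_ [k _ ->] maxk] := @noethR [set I | exists2 k, True & I = J k]%classic.
- move=> _ [k _ ->]; split; first by rewrite /J /= tofrac0 mul0r; apply: loc0.
  move=> a x y xJ yJ; rewrite /J /= tofracD tofracM mulrDl -mulrA.
  by apply: locD => //; apply: locM => //; apply: loc_tofrac.
- by exists (J 0), 0%N.
have sub : (J k.+1 `<=` J k)%classic.
  apply: maxk => [|r]; first by exists k.+1.
  rewrite /J /= => rk; rewrite zkS invf_div mulrA mulrAC.
  by apply: locM => //; apply: ext_loc.
have [b [s [sP zE]]] := zk k.+1.
have bE : b%:F = s%:F * (z / pi ^+ k / pi).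
  by rewrite -zkS zE mulrC divfK ?(notin_prime_neq0 primeP).
have : J k b.
  apply: sub; rewrite /J /= bE -zkS mulfK ?zk0 //.
  exact: loc_tofrac.
rewrite /J /= bE -mulrA [_ / pi / _]mulrAC divff // mul1r => spi.
apply: (ext_not_unit primeP pi0 piP).
rewrite -[pi^-1](mulKf (notin_prime_neq0 primeP sP)).
by apply: locM => //; apply: loc_inv.
Qed.

Let unit z := loc P z /\ loc P z^-1.

Lemma unit_uniformizer_uniq m : unit (pi ^ m) -> m = 0.
Proof.
have piX k : ext_ideal P (pi ^+ k.+1).
  by rewrite exprS mulrC; apply: extMl => //; apply: locX => //; apply: ext_loc.
case: m => [[//|k]|k] [pik pik']; last rewrite NegzE -exprnN invrK in pik'.
  by case: (ext_not_unit primeP _ (piX k) pik'); rewrite expf_neq0.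
by case: (ext_not_unit primeP _ (piX k)); rewrite ?expf_neq0 // exprnN -NegzE.
Qed.

Lemma unitM (x y : {fraction R}) : unit x -> unit y -> unit (x * y).
Proof. by move=> [? ?] [? ?]; split; rewrite ?invfM; apply: locM. Qed.

Lemma unitV (x : {fraction R}) : unit x -> unit x^-1.
Proof. by case=> ? ?; split; rewrite ?invrK. Qed.

(** Divide by [pi] for as long as possible: the last quotient in [R_P] is not a
    multiple of [pi], so it is a unit. *)
Lemma loc_uniformizer z : z != 0 -> loc P z ->
  exists k : nat, unit (z / pi ^+ k).
Proof.
move=> z0 zP; have : exists k, `[< ~ loc P (z / pi ^+ k) >].
  by have [k ?] := uniformizer_bound z0; exists k; apply/asboolP.
move=> /ex_minnP[[|k] /asboolP nk mink]; first by rewrite expr0 divr1 in nk.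
have zk : loc P (z / pi ^+ k).
  by apply: contrapT => /asboolP /mink; rewrite ltnn.
exists k; split=> //; apply: loc_unit => // /pi_div.
by rewrite -mulrA -invfM -exprSr.
Qed.

Lemma frac_uniformizer z : z != 0 -> exists m : int, unit (z / pi ^ m).
Proof.
have [a [b [b0 ->]]] := fraction_split z.
rewrite mulf_eq0 invr_eq0 !tofrac_eq0 (negbTE b0) orbF => a0.
have [||k uk] := @loc_uniformizer a%:F; rewrite ?tofrac_eq0 //; first exact: loc_tofrac.
have [||l ul] := @loc_uniformizer b%:F; rewrite ?tofrac_eq0 //; first exact: loc_tofrac.
exists (k%:Z - l%:Z).
have -> : a%:F / b%:F / pi ^ (k%:Z - l%:Z) = (a%:F / pi ^+ k) * (b%:F / pi ^+ l)^-1.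
  by rewrite expfzDr // invfM -invr_expz invrK invf_div [_ ^+ l / _]mulrC mulrACA.
by apply: unitM => //; apply: unitV.
Qed.

Definition uniformizer_order z : int :=
  if z == 0 then 0 else xget 0 [set m | unit (z / pi ^ m)]%classic.

Lemma uniformizer_orderP z m : z != 0 ->
  uniformizer_order z = m <-> unit (z / pi ^ m).
Proof.
move=> z0; have := xgetPex 0 (frac_uniformizer z0).
rewrite /uniformizer_order (negbTE z0) /=; set v := xget _ _ => uv.
split=> [<- //|um]; apply/eqP; rewrite -subr_eq0; apply/eqP/unit_uniformizer_uniq.
have -> : pi ^ (v - m) = (z / pi ^ m) * (z / pi ^ v)^-1.
  by rewrite expfzDr // -invr_expz invf_div [z / _]mulrC mulrACA divff // mulr1 mulrC.
by apply: unitM => //; apply: unitV.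
Qed.

Lemma uniformizer_orderM (x y : {fraction R}) : x != 0 -> y != 0 ->
  uniformizer_order (x * y) = uniformizer_order x + uniformizer_order y.
Proof.
move=> x0 y0; apply/uniformizer_orderP; first exact: mulf_neq0.
rewrite expfzDr // invfM mulrACA.
by apply: unitM; apply/uniformizer_orderP.
Qed.

Lemma uniformizer_order_ge0 z : z != 0 -> loc P z <-> 0 <= uniformizer_order z.
Proof.
move=> z0; have [zu zu'] : unit (z / pi ^ uniformizer_order z).
  exact/uniformizer_orderP.
split=> [zP|]; last first.
  case: (uniformizer_order z) zu => // k zu _.
  rewrite -[z](divfK (expf_neq0 k pi0)); apply: locM => //.
  by apply: locX => //; apply: ext_loc.
have [k uk] := loc_uniformizer z0 zP.
by have -> : uniformizer_order z = k by apply/uniformizer_orderP.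
Qed.

Lemma uniformizer_order_valuation : discrete_valuation uniformizer_order.
Proof.
have leD (x y : {fraction R}) : x != 0 -> y != 0 -> x + y != 0 ->
    uniformizer_order x <= uniformizer_order y ->
    uniformizer_order x <= uniformizer_order (x + y).
  move=> x0 y0 xy0 le; rewrite -[x + y](divfK x0) uniformizer_orderM //; last first.
    by rewrite mulf_neq0 ?invr_eq0.
  rewrite lerDr; apply/uniformizer_order_ge0; first by rewrite mulf_neq0 ?invr_eq0.
  rewrite mulrDl divff //; apply: locD => //; first exact: loc1.
  apply/uniformizer_order_ge0; first by rewrite mulf_neq0 ?invr_eq0.
  by move: le; rewrite -{1}[y](divfK x0) uniformizer_orderM ?lerDr // mulf_neq0 ?invr_eq0.
split=> [m||x y x0 y0 xy0]; first 1 last.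
- exact: uniformizer_orderM.
- rewrite ge_min; have [le|/ltW le] := leP (uniformizer_order x) (uniformizer_order y).
    by rewrite leD.
  by rewrite addrC leD ?orbT // addrC.
exists (pi ^ m); first exact: expfz_neq0.
apply/uniformizer_orderP; first exact: expfz_neq0.
by rewrite divff ?expfz_neq0 //; split; rewrite ?invr1; apply: loc1.
Qed.

End Uniformizer.
(** * Orders at prime divisors *)

(** Discrete valuations being onto the integers, such a [v] is the order at
    [P]: a uniformizer has order [1]. *)
Definition valuation_at (R : idomainType) (P : {pred R})
    (v : {fraction R} -> int) : Prop :=
  discrete_valuation v /\ forall x, loc P x <-> x = 0 \/ 0 <= v x.

Lemma valuation_of_minimal_prime (R : idomainType) (P : {pred R}) (t : R) :
  noetherian R -> normal_domain R -> t != 0 ->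
  minimal_prime (principal_ideal t) P -> exists v, valuation_at P v.
Proof.
move=> noethR normR t0 minP.
have [pi [pi0 piP pi_div]] := exists_uniformizer noethR normR t0 minP.
exists (uniformizer_order P pi); split.
  exact: (uniformizer_order_valuation noethR minP pi0 piP pi_div).
have ord_ge0 := uniformizer_order_ge0 noethR minP pi0 piP pi_div.
move=> x; have [->|x0] := eqVneq x 0; last rewrite ord_ge0 //.
  by split=> [|_]; [left | apply: loc0; case: minP].
by split=> [|[/eqP|//]]; [right | rewrite (negbTE x0)].
Qed.

Section Valuation.

Variables (R : idomainType) (P : {pred R}) (v : {fraction R} -> int).
Hypotheses (primeP : prime_ideal P) (valv : valuation_at P v).
Implicit Types (x y f : {fraction R}) (m : int).

Lemma valuationM x y : x != 0 -> y != 0 -> v (x * y) = v x + v y.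
Proof. by case: valv => -[_ vM _] _; apply: vM. Qed.

Lemma valuation1 : v 1 = 0.
Proof.
have /eqP := valuationM (oner_neq0 {fraction R}) (oner_neq0 {fraction R}).
by rewrite mulr1 -subr_eq0 opprD addrA subrr sub0r oppr_eq0 => /eqP.
Qed.

Lemma valuationV x : x != 0 -> v x^-1 = - v x.
Proof.
move=> x0; apply/eqP; rewrite eq_sym eqr_oppLR -subr_eq0 opprK addrC.
by rewrite -valuationM ?invr_eq0 // mulVf // valuation1.
Qed.

Lemma valuation_div x y : x != 0 -> y != 0 -> v (x / y) = v x - v y.
Proof. by move=> x0 y0; rewrite valuationM ?invr_eq0 // valuationV. Qed.

Lemma valuationXz x m : x != 0 -> v (x ^ m) = m * v x.
Proof.
move=> x0; have vX (k : nat) : v (x ^+ k) = k%:Z * v x.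
  elim: k => [|k IH]; first by rewrite expr0 valuation1 mul0r.
  by rewrite exprS valuationM ?expf_neq0 // IH intS mulrDl mul1r.
case: m => k; first exact: vX.
by rewrite NegzE -exprnN valuationV ?expf_neq0 // vX mulNr.
Qed.

Lemma valuation_loc x : x != 0 -> loc P x <-> 0 <= v x.
Proof.
case: valv => _ locE x0; rewrite locE; split=> [[/eqP|//]|]; last by right.
by rewrite (negbTE x0).
Qed.

Lemma valuation_ext x : x != 0 -> ext_ideal P x <-> 1 <= v x.
Proof.
move=> x0; split=> [ex|vx].
  have := ext_loc ex; rewrite (valuation_loc x0) le_eqVlt => /orP[/eqP vx|].
    case: (ext_not_unit primeP x0 ex); apply/valuation_loc; rewrite ?invr_eq0 //.
    by rewrite valuationV // -vx.
  by rewrite gtz0_ge1.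
apply: contrapT => nx; have xP : loc P x.
  by apply/valuation_loc => //; apply: le_trans vx.
have := loc_unit xP nx; rewrite valuation_loc ?invr_eq0 // valuationV // oppr_ge0.
by move=> /(le_trans vx).
Qed.

Lemma valuation_tofrac a : a != 0 -> 0 <= v a%:F.
Proof.
by move=> a0; apply/valuation_loc; [rewrite tofrac_eq0 | apply: loc_tofrac].
Qed.

Lemma valuation_mem a : a != 0 -> a \in P <-> 1 <= v a%:F.
Proof.
move=> a0; rewrite -valuation_ext ?tofrac_eq0 //; split; first exact: ext_tofrac.
by apply: (@ext_clear _ _ primeP _ a 1 (notin_prime1 primeP)); rewrite tofrac1 mulr1.
Qed.

Lemma valuation_notin a : a \notin P -> v a%:F = 0.
Proof.
move=> aP; have a0 : a != 0 by apply: contraNneq aP => ->; apply: prime0.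
apply/eqP; rewrite eq_le valuation_tofrac // andbT -ltzD1 ltNge add0r.
by apply: contra aP => /valuation_mem ->.
Qed.

Definition order_ge m : set {fraction R} := [set x | x = 0 \/ m <= v x]%classic.

Lemma order_geP m x : x != 0 -> order_ge m x <-> m <= v x.
Proof.
by move=> x0; split=> [[/eqP|//]|]; [rewrite (negbTE x0) | right].
Qed.

Lemma order_geD m x y : order_ge m x -> order_ge m y -> order_ge m (x + y).
Proof.
have [->|x0] := eqVneq x 0; first by rewrite add0r.
have [->|y0] := eqVneq y 0; first by rewrite addr0.
move=> /(order_geP _ x0) mx /(order_geP _ y0) my.
have [->|xy0] := eqVneq (x + y) 0; first by left.
apply/(order_geP _ xy0); case: valv => -[_ _ vD] _.
by apply: le_trans (vD _ _ x0 y0 xy0); rewrite le_min mx.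
Qed.

Lemma fideal_mul_order_ge m k :
  fideal_mul (order_ge m) (order_ge k) = order_ge (m + k).
Proof.
apply/seteqP; split=> x /=.
  move=> [l [a [b [ab ->]]]].
  elim/big_ind: _ => [|? ?|i _]; [by left | exact: order_geD |].
  have [ai bi] := ab i; have [->|a0] := eqVneq (a i) 0; first by rewrite mul0r; left.
  have [->|b0] := eqVneq (b i) 0; first by rewrite mulr0; left.
  by right; rewrite valuationM // lerD // -order_geP.
have [->|x0] := eqVneq x 0.
  by move=> _; exists 0%N, (fun=> 0), (fun=> 0); rewrite big_ord0; split=> // -[].
rewrite order_geP // => mkx; case: valv => -[vsurj _ _] _; have [y y0 vy] := vsurj m.
exists 1%N, (fun=> y), (fun=> x / y); rewrite big_ord1 mulrCA divff // mulr1.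
split=> // _; split; first by rewrite order_geP // vy.
by right; rewrite valuation_div // vy lerBrDl.
Qed.

Lemma loc_order_ge : loc P = order_ge 0.
Proof. by apply/predeqP => x; case: valv => _; apply. Qed.

Lemma ext_ideal_order_ge : ext_ideal P = order_ge 1.
Proof.
apply/predeqP => x; have [->|x0] := eqVneq x 0; last first.
  by rewrite order_geP // valuation_ext.
by split=> [_|_]; [left | rewrite -tofrac0; apply/ext_tofrac/prime0].
Qed.

Lemma fideal_inv_order_ge : fideal_inv P (ext_ideal P) = order_ge (-1).
Proof.
rewrite ext_ideal_order_ge; apply/predeqP => x.
have [->|x0] := eqVneq x 0.
  by split=> _; [left | move=> y _; rewrite mul0r; apply: loc0].
rewrite order_geP //; split=> [xinv|vx y].
  case: valv => -[vsurj _ _] _; have [y y0 vy] := vsurj 1.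
  have := xinv y; rewrite order_geP // vy lexx => /(_ isT).
  by rewrite valuation_loc ?mulf_neq0 // valuationM // vy -lerBlDr sub0r.
have [->|y0] := eqVneq y 0; first by rewrite mulr0 => _; apply: loc0.
rewrite order_geP // => vy; rewrite valuation_loc ?mulf_neq0 // valuationM //.
by have := lerD vx vy; rewrite addNr.
Qed.

(** Products of the sets [order_ge] add their bounds, since the valuation takes
    all values; this is what computes the powers of [P R_P]. *)
Lemma ext_ideal_pow_order_ge m : ext_ideal_pow P m = order_ge m.
Proof.
have powE a I k : I = order_ge a ->
    iter k (fideal_mul I) (loc P) = order_ge (k%:Z * a).
  move=> ->; elim: k => [|k IH]; first by rewrite mul0r /= loc_order_ge.
  by rewrite iterS IH fideal_mul_order_ge intS mulrDl mul1r.
case: m => k; first by rewrite /= (powE _ _ _ ext_ideal_order_ge) mulr1.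
rewrite [LHS](powE _ _ k.+1 fideal_inv_order_ge).
by rewrite mulrN mulr1 NegzE.
Qed.

Lemma loc_span_order_ge f : f != 0 -> loc_span P f = order_ge (v f).
Proof.
move=> f0; apply/predeqP => x; split=> [[y yP ->]|].
  have [->|y0] := eqVneq y 0; first by rewrite mulr0; left.
  by right; rewrite valuationM // lerDl; apply/valuation_loc.
have [->|x0] := eqVneq x 0.
  by move=> _; exists 0; rewrite ?mulr0 //; apply: loc0.
rewrite order_geP // => fx; exists (x / f); last by rewrite mulrCA divff ?mulr1.
by rewrite valuation_loc ?mulf_neq0 ?invr_eq0 // valuation_div // subr_ge0.
Qed.

Lemma loc_span_ext_ideal_pow f m : f != 0 ->
  loc_span P f = ext_ideal_pow P m <-> v f = m.
Proof.
move=> f0; rewrite loc_span_order_ge // ext_ideal_pow_order_ge.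
split=> [E|-> //]; case: valv => -[vsurj _ _] _; have [y y0 vy] := vsurj m.
apply/eqP; rewrite eq_le; apply/andP; split.
  by rewrite -[X in _ <= X]vy -order_geP // E order_geP // vy.
by rewrite -order_geP // -E order_geP.
Qed.

(** Any nonzero [x] in a prime [Q] contained in [P] divides, in [R_P], a power
    of each element of [P]. *)
Lemma valuation_height_one : height_one P.
Proof.
split=> // [|Q primeQ [x xQ x0] sQP a aP].
  case: valv => -[vsurj _ _] _; have [y y0] := vsurj 1.
  have [a [b [b0 yE]]] := fraction_split y.
  have a0 : a != 0 by apply: contraNneq y0 => a0; rewrite yE a0 tofrac0 mul0r.
  rewrite yE valuation_div ?tofrac_eq0 // => vab; exists a => //.
  apply/valuation_mem => //; rewrite -vab lerBlDr lerDl.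
  exact: valuation_tofrac.
have [->|a0] := eqVneq a 0; first exact: prime0.
have va : 1 <= v a%:F by apply/valuation_mem.
have [k vx] : exists k : nat, v x%:F = k.
  by have := valuation_tofrac x0; case: (v _) => // k _; exists k.
have : loc P (a%:F ^+ k / x%:F).
  have vak : v (a%:F ^+ k) = k%:Z * v a%:F.
    by apply: (@valuationXz _ k%:Z); rewrite tofrac_eq0.
  rewrite valuation_loc ?mulf_neq0 ?invr_eq0 ?expf_neq0 ?tofrac_eq0 //.
  rewrite valuation_div ?expf_neq0 ?tofrac_eq0 // vx vak subr_ge0.
  by rewrite -[X in X <= _]mulr1 ler_wpM2l.
case=> b [s [sP E]]; apply: (mem_primeX primeQ (k := k)).
have : a ^+ k * s \in Q.
  have -> : a ^+ k * s = b * x; last exact: primeMl.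
  apply/eqP; rewrite -tofrac_eq !tofracM tofracXn.
  have x0F : x%:F != 0 by rewrite tofrac_eq0.
  by rewrite -(divfK x0F (a%:F ^+ k)) E mulrAC divfK ?(notin_prime_neq0 primeP).
by case: (primeQ) => _ pQ /pQ/orP[//|/sQP]; rewrite (negbTE sP).
Qed.

End Valuation.

Lemma height_one_minimal (R : idomainType) (P : {pred R}) (x : R) :
  height_one P -> x \in P -> x != 0 -> minimal_prime (principal_ideal x) P.
Proof.
move=> [primeP _ minP] xP x0; split=> // [a|Q primeQ xQ].
  by rewrite inE => /asboolP[b ->]; apply: primeMl.
apply: minP => //; exists x => //; apply: xQ; rewrite inE.
by apply/asboolP; exists 1; rewrite mul1r.
Qed.

Lemma valuation_of_height_one (R : idomainType) (P : {pred R}) :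
  noetherian R -> normal_domain R -> height_one P ->
  exists v, valuation_at P v.
Proof.
move=> noethR normR htP; have [_ [x xP x0] _] := htP.
exact: valuation_of_minimal_prime (height_one_minimal htP xP x0).
Qed.

(** * Principal divisors *)

Lemma prime_divisor_eq (R : idomainType) (P Q : prime_divisor R) :
  {subset P <= Q} -> P = Q.
Proof.
case: P Q => [P htP] [Q htQ] /= sPQ.
have E : P = Q.
  apply/funext => x; apply/idP/idP; first exact: sPQ.
  by case: htQ => _ _ minQ; case: (htP) => primeP nz _; apply: minQ.
by case: Q / E in htQ sPQ *; congr PrimeDivisor; apply: Prop_irrelevance.
Qed.

Section PrincipalDivisors.

Variables (R : idomainType) (v : prime_divisor R -> {fraction R} -> int).
Hypothesis valv : forall P : prime_divisor R, valuation_at P (v P).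

Let primePD (P : prime_divisor R) : prime_ideal P.
Proof. by case: (pd_height_one P). Qed.

Lemma is_divisor_ofE (f : {fraction R}) (D : weil_divisor R) : f != 0 ->
  is_divisor_of f D <-> forall P, v P f = coeff P D.
Proof.
move=> f0; split=> divf P; have := divf P.
  by rewrite (loc_span_ext_ideal_pow (primePD P) (valv P)).
by rewrite (loc_span_ext_ideal_pow (primePD P) (valv P)).
Qed.

(** Orders being additive, the divisors of fractions already form a
    subgroup. *)
Lemma principal_divisorP (D : weil_divisor R) :
  D \in @principal_divisor R <->
  exists2 f : {fraction R}, f != 0 & forall P, v P f = coeff P D.
Proof.
split=> [|[f f0 vf]]; last first.
  by rewrite inE; apply/asboolP => S _; apply; [exact: f0 | apply/is_divisor_ofE].
rewrite inE => /asboolP allS.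
pose S : {pred weil_divisor R} := [pred D | `[< exists2 f : {fraction R},
  f != 0 & forall P, v P f = coeff P D >]].
have /allS : zmod_closed S.
  split.
    apply/asboolP; exists 1; first exact: oner_neq0.
    by move=> P; rewrite coeff0 (valuation1 (valv P)).
  move=> D1 D2 /asboolP[f f0 vf] /asboolP[g g0 vg]; apply/asboolP; exists (f / g).
    by rewrite mulf_neq0 ?invr_eq0.
  by move=> P; rewrite (valuation_div (valv P)) // coeffB vf vg.
move=> /(_ _)/asboolP; apply=> f E f0 /is_divisor_ofE vf.
by apply/asboolP; exists f => // P; apply: vf.
Qed.

End PrincipalDivisors.

(** * Classes of divisors *)

Section DivisorClasses.

Variable R : idomainType.
Implicit Types D E : weil_divisor R.

Lemma divisor_classB D E :
  divisor_class (D - E) = divisor_class D - divisor_class E.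
Proof. exact: raddfB. Qed.

Lemma divisor_class_sum (I : Type) (s : seq I) (F : I -> weil_divisor R) :
  divisor_class (\sum_(i <- s) F i) = \sum_(i <- s) divisor_class (F i).
Proof. exact: raddf_sum. Qed.

Lemma divisor_classMz D (m : int) : divisor_class (D *~ m) = divisor_class D *~ m.
Proof. exact: raddfMz. Qed.

Lemma divisor_class_eq0 D :
  divisor_class D = 0 <-> D \in @principal_divisor R.
Proof.
have -> : 0 = divisor_class (0 : weil_divisor R) by rewrite /divisor_class raddf0.
have := Quotient.idealrBE (@principal_divisor R) D 0; rewrite subr0 => ->.
by split=> [|] /eqP.
Qed.

Lemma divisor_class_surj (c : class_group R) : exists D, c = divisor_class D.
Proof. by elim/quotW: c => D; exists D. Qed.

Lemma weil_divisor_sum D :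
  D = \sum_(P <- dom D) << P >> *~ coeff P D.
Proof.
rewrite -[LHS]freeg_sumE; apply: eq_bigr => P _.
by rewrite freegU_mulz intz.
Qed.

End DivisorClasses.
(** * The toric ring *)

Section ToricRing.

Variables (K : fieldType) (n : nat) (Delta : simplicial_complex n).
Local Notation S := {mpoly K[n.+1]}.
Local Notation R := (toric_ring K Delta).
Local Notation T := ('X_ord_max : S).
Local Notation t := (toric_t K Delta).

Lemma toric_val0 : val (0 : R) = 0.
Proof. exact: rmorph0. Qed.

Lemma toric_val1 : val (1 : R) = 1.
Proof. exact: rmorph1. Qed.

Lemma toric_valD (a b : R) : val (a + b) = val a + val b.
Proof. exact: rmorphD. Qed.

Lemma toric_valM (a b : R) : val (a * b) = val a * val b.
Proof. exact: rmorphM. Qed.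

Lemma toric_valX (a : R) k : val (a ^+ k) = val a ^+ k.
Proof. exact: rmorphXn. Qed.

Lemma toric_val_t : val t = T.
Proof. by rewrite /= /toric_gen big_set0 mul1r. Qed.

Lemma toric_t_neq0 : t != 0.
Proof.
apply/eqP => /(congr1 val); rewrite toric_val_t toric_val0.
move=> /mpolyP/(_ U_(ord_max)%MM)/eqP.
by rewrite mcoeffX eqxx mcoeff0 oner_eq0.
Qed.

Lemma toric_const_in (c : K) : c%:MP_[n.+1] \in toric_pred Delta.
Proof.
have [h1 hZ _] := @toric_pred_subalg_closed K n Delta.
have h0 : (0 : S) \in toric_pred Delta.
  by have := hZ (-1) 1 1 h1 h1; rewrite scaleN1r addNr.
by rewrite -[c%:MP_[n.+1]]mulr1 mul_mpolyC -[_ *: _]addr0 hZ.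
Qed.

Definition toric_const (c : K) : R := ToricRing (toric_const_in c).

Lemma toric_const_is_zmod_morphism : zmod_morphism toric_const.
Proof. by move=> a b; apply: val_inj; rewrite rmorphB /= mpolyCB. Qed.

Lemma toric_const_is_monoid_morphism : monoid_morphism toric_const.
Proof. by split=> [|a b]; apply: val_inj; rewrite ?rmorphM ?rmorph1 /= ?mpolyCM. Qed.

HB.instance Definition _ :=
  GRing.isZmodMorphism.Build K R toric_const toric_const_is_zmod_morphism.
HB.instance Definition _ :=
  GRing.isMonoidMorphism.Build K R toric_const toric_const_is_monoid_morphism.

Lemma toric_ind (A : S -> Prop) :
  A 1 -> (forall c p q, A p -> A q -> A (c *: p + q)) ->
  (forall p q, A p -> A q -> A (p * q)) ->
  (forall F, F \in faces Delta -> A (toric_gen K F)) ->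
  forall a : R, A (val a).
Proof.
move=> A1 AZ AM Agen a.
have /asboolP := toric_valP a.
move=> /(_ [pred p | `[< A p >]]) H; apply/asboolP; apply: H.
  split; first exact/asboolP.
    by move=> c p q /asboolP Ap /asboolP Aq; apply/asboolP; apply: AZ.
  by move=> p q /asboolP Ap /asboolP Aq; apply/asboolP; apply: AM.
by move=> F hF; apply/asboolP; apply: Agen.
Qed.

(** [R] is the image of the polynomial ring with one variable per face. *)
Lemma noetherian_toric : noetherian R.
Proof.
pose gen (i : 'I_#|faces Delta|) : R := ToricRing (toric_gen_in K (enum_valP i)).
pose f : {rmorphism {mpoly K[#|faces Delta|]} -> R} := mmap toric_const gen.
have surj := @noetherian_surj {mpoly K[#|faces Delta|]} R f.
apply: surj => [a|]; last exact: noetherian_mpoly.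
suff [x fx] : exists x, val (f x) = val a by exists x; apply: val_inj.
apply: (@toric_ind (fun p => exists x, val (f x) = p)).
- by exists 1; rewrite !rmorph1.
- move=> c p q [x <-] [y <-]; exists (c%:MP * x + y).
  by rewrite rmorphD rmorphM /= mmapC -mul_mpolyC.
- by move=> p q [x <-] [y <-]; exists (x * y); rewrite rmorphM.
- move=> F hF; exists 'X_(enum_rank_in hF F).
  by rewrite /= mmapX mmap1U /= enum_rankK_in.
Qed.

(** ** The embedding of the polynomial ring into the fraction field *)

(** The value at the index of [x_i] is [(x_i t) / t], a quotient of elements
    of [R]. *)
Definition toric_var (i : 'I_n.+1) : {fraction R} :=
  if unlift ord_max i is Some j
  then (ToricRing (toric_gen_in K (faces1 Delta j)))%:F / t%:F else t%:F.

Definition toric_embed : {rmorphism S -> {fraction R}} :=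
  mmap (@tofrac R \o toric_const) toric_var.
Local Notation phi := toric_embed.

Lemma toric_embedC (c : K) : phi c%:MP = (toric_const c)%:F.
Proof. by rewrite /= mmapC. Qed.

Lemma toric_embed_t : phi T = t%:F.
Proof. by rewrite /= mmapX mmap1U /toric_var unlift_none. Qed.

Lemma toric_embed_var (i : 'I_n) : phi 'X_(widen_ord (leqnSn n) i) =
  (ToricRing (toric_gen_in K (faces1 Delta i)))%:F / t%:F.
Proof.
rewrite /= mmapX mmap1U /toric_var.
have -> : widen_ord (leqnSn n) i = fintype.lift ord_max i.
  by apply: val_inj; rewrite /= /bump leqNgt ltn_ord.
by rewrite liftK.
Qed.

Lemma toric_tF_neq0 : t%:F != 0.
Proof. by rewrite tofrac_eq0 toric_t_neq0. Qed.

Lemma toric_embed_gen (F : {set 'I_n}) (hF : F \in faces Delta) :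
  phi (toric_gen K F) = (ToricRing (toric_gen_in K hF))%:F.
Proof.
pose g i : R := ToricRing (toric_gen_in K (faces1 Delta i)).
have E : ToricRing (toric_gen_in K hF) * t ^+ #|F| = (\prod_(i in F) g i) * t.
  apply: val_inj; rewrite !rmorphM rmorphXn rmorph_prod /=.
  rewrite /toric_gen big_set0 mul1r mulrAC; congr (_ * _).
  rewrite -prodr_const -big_split /=; apply: eq_bigr => i _.
  by rewrite big_set1.
rewrite /toric_gen rmorphM rmorph_prod toric_embed_t.
rewrite (eq_bigr (fun i => (g i)%:F / t%:F)) => [|i _]; last exact: toric_embed_var.
rewrite prodf_div prodr_const -rmorph_prod mulrAC -tofracM -E tofracM tofracXn.
by rewrite mulfK // expf_neq0 // toric_tF_neq0.
Qed.

Lemma toric_embed_val (a : R) : phi (val a) = a%:F.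
Proof.
suff [b [ba ->]] : exists b : R, val b = val a /\ phi (val a) = b%:F.
  by congr (_%:F); apply: val_inj.
apply: (@toric_ind (fun p => exists b : R, val b = p /\ phi p = b%:F)).
- by exists 1; rewrite !rmorph1.
- move=> c p q [a1 [<- p1]] [a2 [<- p2]]; exists (toric_const c * a1 + a2).
  split; first by rewrite toric_valD toric_valM mul_mpolyC.
  by rewrite -mul_mpolyC rmorphD rmorphM toric_embedC p1 p2 tofracD tofracM.
- move=> p q [a1 [<- p1]] [a2 [<- p2]]; exists (a1 * a2).
  by split; [rewrite toric_valM | rewrite rmorphM p1 p2 tofracM].
- move=> F hF; exists (ToricRing (toric_gen_in K hF)); split=> //.
  exact: toric_embed_gen.
Qed.

(** The polynomials satisfying this form a subalgebra, which contains [x_i]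
    since [x_i t] is in [R]. *)
Lemma clear_denominator (p : S) : exists k (a : R), val a = T ^+ k * p.
Proof.
pose cleared (q : S) := exists k (a : R), val a = T ^+ k * q.
have clearM (q r : S) : cleared q -> cleared r -> cleared (q * r).
  move=> [k [a aE]] [l [b bE]]; exists (k + l)%N, (a * b).
  by rewrite toric_valM aE bE exprD mulrACA.
have clearD (q r : S) : cleared q -> cleared r -> cleared (q + r).
  move=> [k [a aE]] [l [b bE]]; exists (k + l)%N, (t ^+ l * a + t ^+ k * b).
  rewrite toric_valD !toric_valM !toric_valX aE bE toric_val_t mulrDr !mulrA.
  by rewrite -!exprD addnC.
have clear1 : cleared 1 by exists 0%N, 1; rewrite mul1r toric_val1.
have clearX i k : cleared ('X_i ^+ k).
  elim: k => [//|k IH]; rewrite exprS; apply: (clearM) IH.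
  case: (unliftP ord_max i) => [j ->|->]; last first.
    by exists 0%N, t; rewrite mul1r toric_val_t.
  exists 1%N, (ToricRing (toric_gen_in K (faces1 Delta j))).
  rewrite /= /toric_gen big_set1 mulrC; congr (_ * 'X__).
  by apply: val_inj; rewrite /= /bump leqNgt ltn_ord.
elim/mpolyind: p => [|c m p _ _ IH].
  by exists 0%N, 0; rewrite mulr0 toric_val0.
apply: (clearD) IH; rewrite -mul_mpolyC; apply: (clearM).
  by exists 0%N, (toric_const c); rewrite mul1r.
by rewrite mpolyXE_id; apply: (big_ind cleared) => [//|//|i _]; apply: clearX.
Qed.

Lemma toric_embed_clear (p : S) k (a : R) : val a = T ^+ k * p ->
  a%:F = t%:F ^+ k * phi p.
Proof. by move=> aE; rewrite -toric_embed_val aE rmorphM rmorphXn toric_embed_t. Qed.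

Lemma toric_embed_eq0 (p : S) : (phi p == 0) = (p == 0).
Proof.
apply/eqP/eqP => [p0|->]; last exact: rmorph0.
have [k [a aE]] := clear_denominator p.
have := toric_embed_clear aE; rewrite p0 mulr0 => /eqP.
rewrite tofrac_eq0 => /eqP a0; move: aE; rewrite a0 toric_val0 => /esym/eqP.
rewrite mulf_eq0 expf_eq0 -toric_val_t -toric_val0 (inj_eq val_inj).
by rewrite (negbTE toric_t_neq0) andbF => /eqP.
Qed.

Lemma toric_embed_frac (x : {fraction R}) :
  exists p q : S, q != 0 /\ x = phi p / phi q.
Proof.
have [a [b [b0 ->]]] := fraction_split x; exists (val a), (val b).
by rewrite -toric_embed_eq0 !toric_embed_val tofrac_eq0.
Qed.

End ToricRing.
(** * Height one primes away from t *)

Section AwayFromT.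

Variables (K : fieldType) (n : nat) (Delta : simplicial_complex n).
Local Notation S := {mpoly K[n.+1]}.
Local Notation R := (toric_ring K Delta).
Local Notation T := ('X_ord_max : S).
Local Notation t := (toric_t K Delta).
Local Notation phi := (toric_embed K Delta).

(** The trace on [R] of the principal ideal generated by [p] in the polynomial
    ring. *)
Definition contraction (p : S) : {pred R} :=
  [pred a | `[< divides p (val a) >]].

Lemma contractionP (p : S) (a : R) : a \in contraction p <-> divides p (val a).
Proof. by rewrite inE; split=> /asboolP. Qed.

Lemma prime_not_divides_X (p : S) k : prime_element p -> ~ divides p T ->
  ~ divides p (T ^+ k).
Proof.
move=> [_ pU pP] npT; elim: k => [|k IH]; last by rewrite exprS => /pP[].
by rewrite expr0 => p1; rewrite (divides_unit p1 (unitr1 _)) in pU.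
Qed.

Lemma prime_contraction (p : S) : prime_element p -> prime_ideal (contraction p).
Proof.
move=> [p0 pU pP]; split; first split.
- by apply/contractionP; exists 0; rewrite mul0r toric_val0.
- apply/negP => /contractionP; rewrite toric_val1 => p1.
  by rewrite (divides_unit p1 (unitr1 _)) in pU.
- move=> a b c /contractionP pb /contractionP pc; apply/contractionP.
  by rewrite toric_valD toric_valM; apply: divides_add => //; apply: divides_mull.
- move=> a b /contractionP; rewrite toric_valM => /pP[?|?]; apply/orP.
    by left; apply/contractionP.
  by right; apply/contractionP.
Qed.

Lemma contraction_notin_t (p : S) : ~ divides p T -> t \notin contraction p.
Proof. by move=> npT; apply/negP => /contractionP; rewrite toric_val_t. Qed.

(** Up to a power of [t], which is invertible modulo [Q], every element of
    [contraction p] is a multiple in [R] of [x]. *)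
Lemma contraction_sub (Q : {pred R}) (p : S) (x : R) k :
  prime_ideal Q -> t \notin Q -> x \in Q -> val x = T ^+ k * p ->
  {subset contraction p <= Q}.
Proof.
move=> primeQ tQ xQ xE a /contractionP[q aE].
have [l [b bE]] := clear_denominator Delta q.
have : a * t ^+ (k + l) \in Q.
  have -> : a * t ^+ (k + l) = b * x; last exact: primeMl.
  apply: val_inj; rewrite !toric_valM toric_valX toric_val_t aE bE xE.
  by rewrite addnC exprD mulrC mulrACA.
case: (primeQ) => _ pQ /pQ/orP[//|/(mem_primeX primeQ)].
by rewrite (negbTE tQ).
Qed.

(** Factor [x] in the polynomial ring and multiply each factor into [R] by a
    power of [t]: as [Q] is prime and avoids [t], it contains one of the
    resulting elements. *)
Lemma prime_factor_in (Q : {pred R}) (x : R) :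
  prime_ideal Q -> t \notin Q -> x \in Q -> x != 0 ->
  exists p : S, [/\ prime_element p, ~ divides p T & {subset contraction p <= Q}].
Proof.
move=> primeQ tQ xQ x0.
have tXQ k : t ^+ k \notin Q by apply: contra tQ => /(mem_primeX primeQ).
suff [p [pp [y [k [yQ yE]]]]] : exists p : S, prime_element p /\
    exists (y : R) k, y \in Q /\ val y = T ^+ k * p.
  exists p; split=> //; last exact: contraction_sub yE.
  move=> [d TE]; have [l [b bE]] := clear_denominator Delta d.
  have /negP := tXQ (k + l).+1; apply.
  have -> : t ^+ (k + l).+1 = b * y; last exact: primeMl.
  apply: val_inj; rewrite toric_valX toric_valM toric_val_t bE yE.
  by rewrite mulrACA -TE -exprD -exprSr addnC.
have : exists y k, y \in Q /\ val y = T ^+ k * val x.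
  by exists x, 0%N; rewrite mul1r.
have : prime_product (val x).
  apply: factorial_mpoly; rewrite -(toric_val0 K Delta) (inj_eq val_inj) //.
elim=> [u uU|p q pp _ IH] [y [k [yQ yE]]].
  have [l [b bE]] := clear_denominator Delta u^-1.
  have /negP[] := tXQ (k + l)%N.
  have -> : t ^+ (k + l) = b * y; last exact: primeMl.
  apply: val_inj; rewrite toric_valX toric_valM toric_val_t bE yE.
  by rewrite mulrACA mulVr // mulr1 -exprD addnC.
have [l [b bE]] := clear_denominator Delta p.
have [m [c cE]] := clear_denominator Delta q.
have : b * c * t ^+ k \in Q.
  have -> : b * c * t ^+ k = t ^+ (l + m) * y; last exact: primeMl.
  apply: val_inj; rewrite !toric_valM !toric_valX toric_val_t bE cE yE.
  by rewrite mulrACA -exprD -mulrA [_ * T ^+ k]mulrC.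
case: (primeQ) => _ pQ /pQ/orP[/pQ/orP[bQ|cQ]|]; last by rewrite (negbTE (tXQ k)).
  by exists p; split=> //; exists b, l.
by apply: IH; exists c, m.
Qed.

Lemma contraction_neq0 (p : S) : prime_element p ->
  exists2 x, x \in contraction p & x != 0.
Proof.
move=> [p0 _ _]; have [k [x xE]] := clear_denominator Delta p; exists x.
  by apply/contractionP; rewrite xE; apply/divides_mull/divides_refl.
apply: contraNneq p0 => x0; rewrite -(toric_embed_eq0 Delta).
have /eqP := toric_embed_clear xE; rewrite x0 tofrac0 eq_sym mulf_eq0 expf_eq0.
by rewrite (negbTE (toric_tF_neq0 K Delta)) andbF.
Qed.

Lemma prime_divides_sym (p q : S) : prime_element p -> prime_element q ->
  divides p q -> divides q p.
Proof.
move=> [p0 pU _] [q0 _ qP] [d qE].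
have : divides q (d * p) by rewrite -qE; apply: divides_refl.
case/qP=> // -[e dE]; case/negP: pU; apply/unitrPr; exists e.
by apply: (mulfI q0); rewrite mulr1 [RHS]qE dE [LHS]mulrC -[LHS]mulrA [LHS]mulrC.
Qed.

(** A smaller nonzero prime contains the contraction of some prime [q], again
    by [prime_factor_in]; then [p] divides [q], so [p] and [q] are
    associates. *)
Lemma height_one_contraction (p : S) : prime_element p -> ~ divides p T ->
  height_one (contraction p).
Proof.
move=> pp npT; split=> [||Q primeQ [x xQ x0] sQp]; [exact: prime_contraction | |].
  exact: contraction_neq0.
have tQ : t \notin Q by apply: contra (contraction_notin_t npT); apply: sQp.
have [q [qq nqT sqQ]] := prime_factor_in primeQ tQ xQ x0.
suff sub : {subset contraction p <= contraction q} by move=> a /sub /sqQ.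
have pq : divides p q.
  have [k [y yE]] := clear_denominator Delta q.
  have /sqQ/sQp/contractionP : y \in contraction q.
    by apply/contractionP; rewrite yE; apply/divides_mull/divides_refl.
  case: (pp) => _ _ pP; rewrite yE => /pP[|//].
  by move/(prime_not_divides_X pp npT).
move=> a /contractionP pa; apply/contractionP.
exact: divides_trans (prime_divides_sym pp qq pq) pa.
Qed.

Definition contraction_divisor (p : S) (pp : prime_element p)
  (npT : ~ divides p T) : prime_divisor R :=
  PrimeDivisor (height_one_contraction pp npT).

Lemma prime_divisor_contraction (Q : prime_divisor R) : t \notin (Q : {pred R}) ->
  exists p (pp : prime_element p) (npT : ~ divides p T),
    Q = contraction_divisor pp npT.
Proof.
move=> tQ; have [primeQ [x xQ x0] minQ] := pd_height_one Q.
have [p [pp npT spQ]] := prime_factor_in primeQ tQ xQ x0.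
exists p, pp, npT; apply/esym/prime_divisor_eq => /=; exact: spQ.
Qed.

(** [t] has total degree one, so a nonconstant divisor leaves a constant
    cofactor. *)
Lemma divides_t_associate (p : S) : prime_element p -> divides p T ->
  exists2 u, u \is a GRing.unit & T = u * p.
Proof.
move=> [p0 pU _] [u TE]; exists u => //.
have T0 : T != 0.
  rewrite -(toric_val_t K Delta) -(toric_val0 K Delta) (inj_eq val_inj).
  exact: toric_t_neq0.
have u0 : u != 0 by apply: contraNneq T0 => u0; rewrite TE u0 mul0r.
have unit1 (q : S) : q != 0 -> (msize q <= 1)%N -> q \is a GRing.unit.
  move=> q0 /msize1_polyC qE; have c0 : q@_0 != 0.
    by apply: contraNneq q0 => c0; rewrite qE c0.
  by apply/unitrPr; exists (q@_0)^-1%:MP; rewrite {1}qE -mpolyCM mulfV.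
have := congr1 (fun q : S => msize q) TE; rewrite msizeM // msizeX mdeg1.
have : (1 < msize p)%N by rewrite ltnNge; apply: contra pU; apply: unit1.
move=> sp sE; apply: unit1 => //.
rewrite leqNgt; apply/negP => su; have := leq_add su sp.
by move: sE; case: (addn _ _) => [|[|[|[|k]]]].
Qed.

(** ** Orders at primes away from t *)

Variable v : prime_divisor R -> {fraction R} -> int.
Hypothesis valv : forall P : prime_divisor R, valuation_at P (v P).

Let primePD (P : prime_divisor R) : prime_ideal P.
Proof. by case: (pd_height_one P). Qed.

Lemma embed_neq0 (p : S) : p != 0 -> phi p != 0.
Proof. by rewrite toric_embed_eq0. Qed.

Lemma clear_neq0 (p : S) k (a : R) : p != 0 -> val a = T ^+ k * p -> a != 0.
Proof.
move=> p0 aE; rewrite -tofrac_eq0 (toric_embed_clear aE).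
by rewrite mulf_neq0 ?embed_neq0 ?expf_neq0 ?toric_tF_neq0.
Qed.

Lemma order_clear (P : prime_divisor R) (p : S) k (a : R) : p != 0 ->
  val a = T ^+ k * p -> v P a%:F = k%:Z * v P t%:F + v P (phi p).
Proof.
move=> p0 /toric_embed_clear ->; have t0 := toric_tF_neq0 K Delta.
rewrite (valuationM (valv P)) ?expf_neq0 ?embed_neq0 //; congr (_ + _).
exact: (valuationXz (valv P) k%:Z t0).
Qed.

Lemma orderM (P : prime_divisor R) (p q : S) : p != 0 -> q != 0 ->
  v P (phi (p * q)) = v P (phi p) + v P (phi q).
Proof.
by move=> p0 q0; rewrite rmorphM (valuationM (valv P)) ?embed_neq0.
Qed.

Lemma order_t_away (Q : prime_divisor R) : t \notin (Q : {pred R}) -> v Q t%:F = 0.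
Proof. exact: valuation_notin. Qed.

Lemma order_divides (Q : prime_divisor R) (p q : S) : t \notin (Q : {pred R}) ->
  p != 0 -> q != 0 -> divides p q -> v Q (phi p) <= v Q (phi q).
Proof.
move=> tQ p0 q0 [d qE].
have d0 : d != 0 by apply: contraNneq q0 => d0; rewrite qE d0 mul0r.
rewrite qE rmorphM (valuationM (valv Q)) ?embed_neq0 // lerDr.
have [k [a aE]] := clear_denominator Delta d.
have := order_clear Q d0 aE; rewrite (order_t_away tQ) mulr0 add0r => <-.
apply: (valuation_tofrac (primePD Q) (valv Q)).
exact: clear_neq0 aE.
Qed.

Lemma order_contraction (p : S) (pp : prime_element p) (npT : ~ divides p T) (q : S) :
  q != 0 -> divides p q <-> 1 <= v (contraction_divisor pp npT) (phi q).
Proof.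
move=> q0; set Q := contraction_divisor pp npT.
have tQ : t \notin (Q : {pred R}) := contraction_notin_t npT.
have [k [a aE]] := clear_denominator Delta q.
have a0 : a != 0.
  exact: clear_neq0 aE.
have := order_clear Q q0 aE; rewrite (order_t_away tQ) mulr0 add0r => <-.
rewrite -(valuation_mem (primePD Q) (valv Q) a0) (contractionP p a) aE.
split=> [|]; first exact: divides_mull.
by have [_ _ pP] := pp; move=> /pP[/(prime_not_divides_X pp npT)|].
Qed.

(** Orders at [Q] are onto, so some element [a] of [Q] has order one; it is a
    multiple of [p], whose order is therefore at most one. *)
Lemma order_contraction_gen (p : S) (pp : prime_element p) (npT : ~ divides p T) :
  v (contraction_divisor pp npT) (phi p) = 1.
Proof.
set Q := contraction_divisor pp npT; have [p0 _ _] := pp.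
have tQ : t \notin (Q : {pred R}) := contraction_notin_t npT.
apply/eqP; rewrite eq_le; apply/andP; split; last first.
  by rewrite -(order_contraction pp npT p0); apply: divides_refl.
case: (valv Q) => -[vsurj _ _] _; have [x x0 vx] := vsurj 1.
have : ext_ideal Q x by apply/(valuation_ext (primePD Q) (valv Q) x0); rewrite vx.
move=> [a [s [aQ sQ xE]]].
have sF0 : s%:F != 0 := notin_prime_neq0 (primePD Q) sQ.
have a0 : a%:F != 0 by apply: contraNneq x0 => a0; rewrite xE a0 mul0r.
have va : v Q a%:F = 1.
  have := valuation_div (valv Q) a0 sF0; rewrite -xE vx.
  by rewrite (valuation_notin (primePD Q) (valv Q) sQ) subr0 => <-.
have le : v Q (phi p) <= v Q (phi (val a)).
  apply: order_divides => //; last exact/contractionP.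
  by rewrite -(toric_embed_eq0 Delta) toric_embed_val.
by apply: le_trans le _; rewrite toric_embed_val va.
Qed.

Lemma order_unit (P : prime_divisor R) (u : S) : u \is a GRing.unit ->
  v P (phi u) = 0.
Proof.
move=> uU; have phiU (w : S) : w \is a GRing.unit -> 0 <= v P (phi w).
  move=> wU; have wE : w = (w@_0)%:MP by case/andP: wU => /eqP.
  have w0 : w != 0 by apply: contraTneq wU => ->; rewrite unitr0.
  rewrite wE toric_embedC; apply: (valuation_tofrac (primePD P) (valv P)).
  by rewrite -tofrac_eq0 -toric_embedC -wE embed_neq0.
have u0 : u != 0 by apply: contraTneq uU => ->; rewrite unitr0.
have := phiU u^-1; rewrite unitrV => /(_ uU).
rewrite rmorphV // (valuationV (valv P)) ?embed_neq0 // oppr_ge0 => le0.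
by apply/eqP; rewrite eq_le le0 phiU.
Qed.

Lemma order_contraction_other (p : S) (pp : prime_element p)
    (npT : ~ divides p T) (Q : prime_divisor R) :
  t \notin (Q : {pred R}) -> Q != contraction_divisor pp npT ->
  v Q (phi p) = 0.
Proof.
have [p0 _ _] := pp; move=> /[dup]/prime_divisor_contraction[q [qq [nqT ->]]] tQ neq.
have ge0 : 0 <= v (contraction_divisor qq nqT) (phi p).
  rewrite -(order_unit (contraction_divisor qq nqT) (unitr1 _)).
  by apply: order_divides => //; [apply: oner_neq0 | exists p; rewrite mulr1].
apply/eqP; rewrite eq_le ge0 andbT -ltzD1 ltNge add0r; apply: contra neq.
rewrite -(order_contraction qq nqT p0) => qp; apply/eqP/esym/prime_divisor_eq => a.
by move=> /contractionP pa; apply/contractionP; apply: divides_trans pa.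
Qed.

Lemma order_divides_t (P : prime_divisor R) (p : S) :
  prime_element p -> divides p T -> v P (phi p) = v P t%:F.
Proof.
move=> pp /(divides_t_associate pp)[u uU TE]; have [p0 _ _] := pp.
have u0 : u != 0 by apply: contraTneq uU => ->; rewrite unitr0.
by rewrite -toric_embed_t TE orderM // (order_unit P uU) add0r.
Qed.

(** Unique factorization, read on orders.  A prime factor of [p] or [q] that
    does not divide [t] defines a prime divisor away from [t], hence occurs in
    the other polynomial too; what is left is a unit times a power of [t]. *)
Lemma same_orders_away (p q : S) : p != 0 -> q != 0 ->
  (forall Q : prime_divisor R, t \notin (Q : {pred R}) ->
     v Q (phi p) = v Q (phi q)) ->
  exists m : int, forall P : prime_divisor R,
    v P (phi p) = v P (phi q) + m * v P t%:F.
Proof.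
move=> p0; elim: (factorial_mpoly p0) q => [u uU|d r dd ppr IH] q q0 E.
  elim: (factorial_mpoly q0) E => [w wU|d r dd ppr IH] E.
    by exists 0 => P; rewrite !order_unit // mul0r addr0.
  have [d0 _ _] := dd; have r0 := prime_product_neq0 ppr.
  have [dT|ndT] := pselect (divides d T); last first.
    have dr : divides d (d * r) by apply/divides_mulr/divides_refl.
    move: dr; rewrite (order_contraction dd ndT (mulf_neq0 d0 r0)).
    by rewrite -E ?order_unit //; apply: contraction_notin_t.
  have [Q tQ|m vm] := IH.
    by rewrite E // orderM // (order_divides_t Q dd dT) (order_t_away tQ) add0r.
  exists (m - 1) => P; rewrite orderM // (order_divides_t P dd dT) vm mulrBl mul1r.
  by rewrite [v P t%:F + _]addrC -addrA [v P t%:F + _]addrC subrK.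
have [d0 _ _] := dd; have r0 := prime_product_neq0 ppr.
have [dT|ndT] := pselect (divides d T).
  have [//|Q tQ|m vm] := IH q.
    by rewrite -E // orderM // (order_divides_t Q dd dT) (order_t_away tQ) add0r.
  exists (m + 1) => P; rewrite orderM // (order_divides_t P dd dT) vm mulrDl mul1r.
  by rewrite addrCA [v P t%:F + _]addrC.
have : divides d q.
  rewrite (order_contraction dd ndT q0) -E ?contraction_notin_t //.
  rewrite -(order_contraction dd ndT (mulf_neq0 d0 r0)).
  exact/divides_mulr/divides_refl.
move=> [q' qE].
have q'0 : q' != 0 by apply: contraNneq q0 => q'0; rewrite qE q'0 mul0r.
have [//|Q tQ|m vm] := IH q'.
  by have := E Q tQ; rewrite qE !orderM // addrC => /addIr.
by exists m => P; rewrite qE !orderM // vm addrAC [v P (phi d) + _]addrC addrAC.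
Qed.

Lemma order_away_eq0 (f : {fraction R}) : f != 0 ->
  (forall Q : prime_divisor R, t \notin (Q : {pred R}) -> v Q f = 0) ->
  exists m : int, forall P : prime_divisor R, v P f = m * v P t%:F.
Proof.
have [p [q [q0 ->]]] := toric_embed_frac f => f0 vf.
have p0 : p != 0 by apply: contraNneq f0 => ->; rewrite rmorph0 mul0r.
have vpq P : v P (phi p / phi q) = v P (phi p) - v P (phi q).
  by rewrite (valuation_div (valv P)) ?embed_neq0.
have [//|//|Q tQ|m vm] := @same_orders_away p q.
  by apply/eqP; rewrite -subr_eq0 -vpq vf.
by exists m => P; rewrite vpq vm addrC addKr.
Qed.

End AwayFromT.

(** * The class group of the toric ring *)

Section Combinations.

Variables (R : idomainType) (r : nat) (p : 'I_r -> prime_divisor R).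
Hypothesis p_inj : injective p.
Implicit Types (b : 'I_r -> int) (Q : prime_divisor R).

Definition combination b : weil_divisor R := \sum_(i < r) << p i >> *~ b i.

Lemma coeff_combination b Q :
  coeff Q (combination b) = \sum_(i < r) b i * (p i == Q)%:R.
Proof.
rewrite raddf_sum; apply: eq_bigr => i _ /=.
by rewrite freegU_mulz coeffU intz.
Qed.

Lemma coeff_combination_in b j : coeff (p j) (combination b) = b j.
Proof.
rewrite coeff_combination (bigD1 j) //= eqxx mulr1 big1 ?addr0 // => i ij.
by rewrite (inj_eq p_inj) (negbTE ij) mulr0.
Qed.

Lemma coeff_combination_notin b Q : (forall i, p i != Q) ->
  coeff Q (combination b) = 0.
Proof.
by move=> pQ; rewrite coeff_combination big1 // => i _; rewrite (negbTE (pQ i)) mulr0.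
Qed.

Lemma divisor_class_combination b :
  divisor_class (combination b) = \sum_(i < r) prime_class (p i) *~ b i.
Proof.
by rewrite divisor_class_sum; apply: eq_bigr => i _; rewrite divisor_classMz.
Qed.

End Combinations.

Theorem theorem1p1 (K : fieldType) (n : nat) (Delta : simplicial_complex n)
    (r : nat) (P : 'I_r -> {pred toric_ring K Delta}) :
  normal_domain (toric_ring K Delta) ->
  injective P ->
  (forall Q : {pred toric_ring K Delta},
     minimal_prime (principal_ideal (toric_t K Delta)) Q <->
     exists i : 'I_r, Q = P i) ->
  exists p : 'I_r -> prime_divisor (toric_ring K Delta),
  [/\ forall i : 'I_r, pd_ideal (p i) = P i,
      forall c : class_group (toric_ring K Delta),
        exists b : 'I_r -> int, c = \sum_(i < r) prime_class (p i) *~ b i,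
      forall i : 'I_r, is_dvr (loc (P i))
    & exists a : 'I_r -> int,
        (forall i : 'I_r,
           loc_span (P i) (toric_t K Delta)%:F = ext_ideal_pow (P i) (a i)) /\
        (forall b : 'I_r -> int,
           \sum_(i < r) prime_class (p i) *~ b i = 0 <->
           exists m : int, forall i : 'I_r, b i = m * a i)].
Proof.
set R := toric_ring K Delta; set t := toric_t K Delta => normR injP minP.
have t0 : t != 0 := toric_t_neq0 K Delta.
have tF0 : t%:F != 0 := toric_tF_neq0 K Delta.
have noethR := @noetherian_toric K n Delta.
have minPi i : minimal_prime (principal_ideal t) (P i) by apply/minP; exists i.
have htPi i : height_one (P i).
  have [w valw] := valuation_of_minimal_prime noethR normR t0 (minPi i).
  by apply: valuation_height_one valw; case: (minPi i).
pose p i := PrimeDivisor (htPi i).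
have p_inj : injective p by move=> i j /(congr1 (@pd_ideal R)) /injP.
have tp i : t \in (p i : {pred R}) := minimal_prime_mem (minPi i).
have t_prime (Q : prime_divisor R) : t \in (Q : {pred R}) -> exists i, Q = p i.
  move=> tQ; have := height_one_minimal (pd_height_one Q) tQ t0.
  move=> /minP[i QE]; exists i; apply: prime_divisor_eq => x.
  by rewrite QE.
have p_away (Q : prime_divisor R) : t \notin (Q : {pred R}) -> forall i, p i != Q.
  by move=> tQ i; apply: contraNneq tQ => <-; apply: tp.
have /choice[v valv] : forall Q : prime_divisor R, exists v, valuation_at Q v.
  by move=> Q; apply: valuation_of_height_one; [| | apply: pd_height_one].
exists p; split=> // [c|i|].
- pose gen (c : class_group R) := exists b : 'I_r -> int,
    c = \sum_(i < r) prime_class (p i) *~ b i.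
  have gen0 : gen 0.
    by exists (fun=> 0); rewrite big1 // => i _; rewrite mulr0z.
  have genD c1 c2 : gen c1 -> gen c2 -> gen (c1 + c2).
    move=> [b1 ->] [b2 ->]; exists (fun i => b1 i + b2 i).
    by rewrite -big_split; apply: eq_bigr => i _; rewrite mulrzDr.
  have genMz c1 m : gen c1 -> gen (c1 *~ m).
    move=> [b ->]; exists (fun i => b i * m).
    by rewrite mulrz_suml; apply: eq_bigr => i _; rewrite mulrzA.
  have genQ Q : gen (prime_class Q).
    have [tQ|tQ] := boolP (t \in (Q : {pred R})).
      have [j ->] := t_prime Q tQ; exists (fun i => (i == j)%:R).
      rewrite (bigD1 j) //= eqxx mulr1z big1 ?addr0 // => i /negbTE ->.
      by rewrite mulr0z.
    have [g [gg [ngT QE]]] := prime_divisor_contraction tQ.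
    have [g0 _ _] := gg.
    pose f := toric_embed K Delta g.
    have f0 : f != 0 := embed_neq0 Delta g0.
    (* [div f = Q + \sum_i v (p i) f *: P_i]. *)
    exists (fun i => - v (p i) f).
    rewrite -divisor_class_combination; apply/eqP.
    rewrite -subr_eq0 /prime_class -divisor_classB; apply/eqP/divisor_class_eq0.
    apply/(principal_divisorP valv); exists f => // Q'.
    rewrite coeffB coeffU mul1r.
    have [tQ'|tQ'] := boolP (t \in (Q' : {pred R})).
      have [j ->] := t_prime Q' tQ'; rewrite coeff_combination_in // opprK.
      by rewrite eq_sym (negbTE (p_away _ tQ j)) add0r.
    rewrite coeff_combination_notin ?subr0; last exact: p_away.
    have [<-|QQ'] := eqVneq Q Q'; first by rewrite QE order_contraction_gen.
    apply: (order_contraction_other valv tQ' (pp := gg) (npT := ngT)).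
    by rewrite -QE eq_sym.
  have [D ->] := divisor_class_surj c; rewrite [D]weil_divisor_sum.
  rewrite divisor_class_sum; elim/big_ind: _ => // Q _.
  by rewrite divisor_classMz; apply: genMz; apply: genQ.
- have [dv vE] := valv (p i); by exists (v (p i)).
exists (fun i => v (p i) t%:F); split=> [i|b].
  by apply/(loc_span_ext_ideal_pow _ (valv (p i))) => //; case: (htPi i).
rewrite -divisor_class_combination divisor_class_eq0 (principal_divisorP valv).
split=> [[f f0 vf]|[m bE]].
  have [Q tQ|m vm] := order_away_eq0 valv f0.
    by rewrite vf coeff_combination_notin //; apply: p_away.
  by exists m => i; rewrite -vm vf coeff_combination_in.
exists (t%:F ^ m) => [|Q]; first exact: expfz_neq0.
rewrite (valuationXz (valv Q)) //.
have [tQ|tQ] := boolP (t \in (Q : {pred R})).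
  by have [j ->] := t_prime Q tQ; rewrite coeff_combination_in // bE.
rewrite coeff_combination_notin; last exact: p_away.
by rewrite (order_t_away valv tQ) mulr0.
Qed.
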